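(* Let $G$ be a plane graph with double chamber system $C$ (with permutations $s_1,s_2$ of $C$), and let $D=(E,\sigma,\theta)$ be the double chamber decoration of a lopsp operation, with special vertices $v_0,v_1,v_2$. Let $P$ and $Q$ be two simple paths in $D$ between $v_1$ and $v_2$ through $v_0$. Then there exists an isomorphism between the plane graphs $D_P(G)$ and $D_Q(G)$, where $D_P(G)$ and $D_Q(G)$ denote the application of $(D,P)$, respectively $(D,Q)$, to $G$.
   Context: **Plane graphs.** A plane graph is given as a triple $(E,\sigma,\theta)$, where $E$ is a set of directed edges, $\sigma$ is a permutation of $E$ ($\sigma(e)$ is the next edge with the same source vertex as $e$ in clockwise direction) and $\theta$ is a fixed-point-free involution of $E$ ($\theta(e)$ is the inverse edge of $e$). Vertices are the orbits of $\langle\sigma\rangle$ (the orbit of a vertex is the set of directed edges with that source); faces are the orbits of $\langle\sigma\theta\rangle$ (the edges having the face on their left), and the size of a face is the size of its orbit. Multiple edges are allowed. An isomorphism between plane graphs $(E,\sigma,\theta)$ and $(E',\sigma',\theta')$ is a bijection $f:E\to E'$ with $f\sigma=\sigma' f$ and $f\theta=\theta' f$. **Chamber systems.** The chamber system $C_G$ of a plane graph $G$ is its barycentric subdivision: each edge is subdivided by one vertex in its centre, one vertex is added in the centre of each face, and edges are added from each face centre to the vertices and the edge centres of that face. It is a triangulation. A vertex of $C_G$ has type $0$, $1$ or $2$ if it corresponds to a vertex, edge or face of $G$ respectively; an edge of $C_G$ has as type $t(e)$ the type of the opposite vertex in an adjacent triangle. The triangles are called chambers. A double chamber is a pair of chambers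 sharing a type-$0$ edge. **Lopsp operations.** A tiling $T$ of the Euclidean plane is regarded as an (infinite) plane graph, with chamber system $C_T$. A lopsp operation is a triple $(T,v_0,v_2)$ where $T$ is a connected tiling of the Euclidean plane and $v_0\neq v_2$ are points in the plane such that the rotation $\rho_{v_0}$ by 120 degrees clockwise with centre $v_0$ and the rotation $\rho_{v_2}$ by 60 degrees clockwise with centre $v_2$ are symmetries of $T$. The rotation $\rho_{v_1}=\rho_{v_2}\circ\rho_{v_0}$ is a rotation by 180 degrees; its centre is denoted $v_1$. The points $v_0,v_1,v_2$ are vertices of $C_T$. **Double chamber decoration.** Write $C_T=(E_T,\sigma_T,\theta_T)$ with edge types $t$. The group $\langle\rho_{v_0},\rho_{v_2}\rangle$ acts on $E_T$, commuting with $\sigma_T,\theta_T$ and preserving $t$. Let $E=E_T/\langle\rho_{v_0},\rho_{v_2}\rangle$ be the set of orbits $\overline e$, and put $\sigma(\overline e)=\overline{\sigma_T(e)}$, $\theta(\overline e)=\overline{\theta_T(e)}$, $\overline t(\overline e)=t(e)$ (these are well-defined). The plane graph $D=(E,\sigma,\theta)$ together with $\overline t$ and the special vertices $v_0,v_1,v_2$ (the images in $D$ of the corresponding vertices of $C_T$) is the double chamber decoration of $(T,v_0,v_2)$. **Double chamber system.** For a plane graph $G=(E_G,\sigma_G,\theta_G)$, directed edges $e$ of $G$ are in one-to-one correspondence with double chambers $c_e$ of $C_G$. The double chamber system of $G$ is the set $C=\{c_e : e\in E_G\}$ of double chambers along with the permutations $s_1(c_e)=c_{\theta_G(e)}$ and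 $s_2(c_e)=c_{\sigma_G^{-1}\theta_G(e)}$. **Application.** Let $P$ be a simple path in $D=(E,\sigma,\theta)$ between $v_1$ and $v_2$ through $v_0$. Let $P_2$ be the set of directed edges on the part of the path directed from $v_2$ to $v_0$, and $P_2'$ the set of their inverses; let $P_1$ be the set of directed edges on the part of the path directed from $v_1$ to $v_0$, and $P_1'$ the set of their inverses. For $e\in E$ put $s_{P,e}=s_2$ if $e\in P_2$, $s_{P,e}=s_1^{-1}$ if $e\in P_1$, $s_{P,e}=s_2^{-1}$ if $e\in P_2'$, $s_{P,e}=s_1$ if $e\in P_1'$, and $s_{P,e}$ the identity otherwise. The application of $(D,P)$ to $G$ is the plane graph $D_P(G)=(E\times C,\sigma_P,\theta_P)$ with $\sigma_P((e,c))=(\sigma(e),s_{P,e}(c))$ and $\theta_P((e,c))=(\theta(e),s_{P,e}(c))$. *)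

(* Defs.v *)
From mathcomp Require Import all_boot all_order all_algebra.
From mathcomp Require Import generic_quotient ring.
From mathcomp Require Import all_classical all_reals all_analysis.

Set Implicit Arguments.
Unset Strict Implicit.
Unset Printing Implicit Defensive.

Import Order.TTheory GRing.Theory Num.Theory.
Import numFieldNormedType.Exports.

Local Open Scope classical_set_scope.
Local Open Scope ring_scope.
Local Open Scope quotient_scope.

(* [E] may be infinite, so the permutation [sigma] comes with its (unique)
   inverse [sigmaV]. *)
Record plane_graph := PlaneGraph {
  dart :> choiceType;
  sigma : dart -> dart;
  sigmaV : dart -> dart;
  theta : dart -> dart;
  sigmaK : cancel sigma sigmaV;
  sigmaVK : cancel sigmaV sigma;
  thetaK : involutive theta;
  theta_free : forall e, theta e <> e }.

(* The orbit of [e] under <sigma>, i.e. the source vertex of [e]; [iter] in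
   both directions because the orbit may be infinite. *)
Definition vertex (G : plane_graph) (e : G) : set G :=
  [set e' | exists n, e' = iter n (@sigma G) e \/ e = iter n (@sigma G) e'].

Definition is_isomorphism (G G' : plane_graph) (f : G -> G') : Prop :=
  [/\ bijective f,
      forall e, f (sigma e) = sigma (f e) &
      forall e, f (theta e) = theta (f e)].

Definition isomorphic (G G' : plane_graph) : Prop :=
  exists f : G -> G', is_isomorphism f.

Definition connected_graph (G : plane_graph) : Prop :=
  forall A : set G,
    (forall e, A e <-> A (sigma e)) -> (forall e, A e <-> A (theta e)) ->
    A = set0 \/ A = setT.

(* [(e, true)] is the chamber formed by the source of [e], the centre of [e]
   and the centre of the face on the left of [e]; in [(e, false)] the source
   of [e] is replaced by its target.  The boundary of [(e, true)] visits its
   vertices of type 0, 1, 2 in counterclockwise order, that of [(e, false)] in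
   clockwise order. *)
Definition chamber (G : plane_graph) : choiceType := (G * bool)%type.

(* The chamber sharing with [x] its side of type [i].  The dart following [e]
   on the face at its left is [sigma (theta e)]. *)
Definition adj (G : plane_graph) (i : 'I_3) (x : chamber G) : chamber G :=
  match val i, x with
  | 0%N, (e, b) => (e, ~~ b)
  | 1%N, (e, true) => (theta (sigmaV e), false)
  | 1%N, (e, false) => (sigma (theta e), true)
  | _, (e, b) => (theta e, ~~ b)
  end.

(* Chambers reached from [x] by crossing sides whose type is in [I]. *)
Inductive linked (G : plane_graph) (I : pred 'I_3) (x : chamber G) :
    chamber G -> Prop :=
  | linked_refl : linked I x x
  | linked_adj y i : linked I x y -> I i -> linked I x (adj i y).

(* Addition on ['I_3] is modulo 3. *)
Definition turn (b : bool) (i : 'I_3) : 'I_3 := if b then i + 1 else i - 1.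

Lemma adjK (G : plane_graph) (i : 'I_3) : involutive (@adj G i).
Proof.
case: i => [[|[|[|i]]] lti] // [e b]; rewrite /adj /=.
- by rewrite negbK.
- by case: b => /=; rewrite ?(thetaK, sigmaVK, sigmaK).
- by rewrite thetaK negbK.
Qed.

Lemma adj_snd (G : plane_graph) (i : 'I_3) (x : chamber G) :
  (adj i x).2 = ~~ x.2.
Proof. by case: i => [[|[|[|i]]] lti] //; case: x => e [|]. Qed.

Lemma turnK b : cancel (turn b) (turn (~~ b)).
Proof. by case: b => i; rewrite /turn /= ?addrK ?subrK. Qed.

(* A directed edge of the chamber system is a pair [(x, i)]: the side of type
   [i] of the chamber [x], directed so that [x] lies on its left.  The next
   side of [x] counterclockwise has type [turn x.2 i]; as the faces are the
   orbits of sigma o theta, this determines sigma from theta. *)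
Section ChamberSystem.
Variable G : plane_graph.
Definition cdart : choiceType := (chamber G * 'I_3)%type.

Definition csigma (d : cdart) : cdart :=
  let x := adj d.2 d.1 in (x, turn x.2 d.2).
Definition csigmaV (d : cdart) : cdart :=
  let i := turn (~~ d.1.2) d.2 in (adj i d.1, i).
Definition ctheta (d : cdart) : cdart := (adj d.2 d.1, d.2).

Lemma csigmaK : cancel csigma csigmaV.
Proof. by case=> x i; rewrite /csigma /csigmaV /= turnK adjK. Qed.
Lemma csigmaVK : cancel csigmaV csigma.
Proof.
case=> x i; rewrite /csigma /csigmaV /= adjK; congr pair.
by have := turnK (~~ x.2) i; rewrite negbK.
Qed.
Lemma cthetaK : involutive ctheta.
Proof. by case=> x i; rewrite /ctheta /= adjK. Qed.
Lemma ctheta_free d : ctheta d <> d.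
Proof.
case: d => x i /(congr1 (fun d : cdart => d.1.2)) /=.
by rewrite adj_snd; case: x.2.
Qed.

Definition chamber_system : plane_graph :=
  PlaneGraph csigmaK csigmaVK cthetaK ctheta_free.
End ChamberSystem.

(* The type of the source vertex of the side [i] of [x]: in counterclockwise
   order the vertices of [x] are met in the same cyclic order of types as its
   sides, and side [i] does not contain vertex [i]. *)
Definition source_type (G : plane_graph) (d : chamber_system G) : 'I_3 :=
  turn d.1.2 d.2.

Section Geometry.
Variable R : realType.

Definition plane : Type := (R * R)%type.

Definition add_polar (c : plane) (r phi : R) : plane :=
  (c.1 + r * cos phi, c.2 + r * sin phi).

(* The clockwise rotation by [a] with centre [c]. *)
Definition rotation (c : plane) (a : R) (z : plane) : plane :=
  let dx := z.1 - c.1 in let dy := z.2 - c.2 in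
  (c.1 + (cos a * dx + sin a * dy), c.2 + (cos a * dy - sin a * dx)).

(* The standard closed triangle in barycentric coordinates: [p 0 i = 0] is the
   side of type [i], and [corner i] the opposite vertex. *)
Definition triangle : set 'rV[R]_3 :=
  [set p | (forall i, 0 <= p 0 i) /\ \sum_i p 0 i = 1].

Definition corner (i : 'I_3) : 'rV[R]_3 := delta_mx 0 i.

Definition barycentre : 'rV[R]_3 := const_mx 3^-1.

(* The boundary of the triangle, parametrised by [0, 3]: it is at corners
   0, 1, 2, 0 at the times 0, 1, 2, 3 and affine in between. *)
Definition boundary (u : R) : 'rV[R]_3 :=
  \row_(i < 3)
    match val i with
    | 0%N => Num.max 0 (1 - u) + Num.max 0 (u - 2)
    | 1%N => Num.max 0 (1 - `|u - 1|)
    | _ => Num.max 0 (1 - `|u - 2|)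
    end.

(* Along the curve [g] on [0, 3] the angle seen from [c] increases by [a]. *)
Definition angle_variation (g : R -> plane) (c : plane) (a : R) : Prop :=
  exists r phi : R -> R,
    [/\ {within `[0, 3], continuous phi},
        forall u, 0 <= u <= 3 -> 0 < r u /\ g u = add_polar c (r u) (phi u) &
        phi 3 - phi 0 = a].

(* A connected plane graph with its chamber system drawn as a locally finite
   triangulation of the whole plane: every chamber is drawn as a topological
   closed triangle, and two chambers meet exactly in the sides and vertices
   that they have in common in the chamber system. *)
Record tiling := Tiling {
  tgraph :> plane_graph;
  tconnected : connected_graph tgraph;
  draw : chamber tgraph -> 'rV[R]_3 -> plane;
  draw_continuous : forall x, {within triangle, continuous (draw x)};
  draw_eq : forall x y p q, triangle p -> triangle q ->
    draw x p = draw y q <->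
    p = q /\ linked [pred i | p 0 i == 0] x y;
  draw_cover : forall z : plane, exists x, exists2 p, triangle p & draw x p = z;
  draw_locally_finite : forall z : plane, exists2 U, nbhs z U &
    finite_set [set x | (draw x @` triangle) `&` U !=set0];
  draw_orientation : forall x,
    angle_variation (draw x \o boundary) (draw x barycentre)
      (if x.2 then pi *+ 2 else - (pi *+ 2)) }.

(* The drawing of [x] ([I] empty), of one of its sides ([I] a singleton) or of
   one of its vertices ([I] a pair). *)
Definition cell (T : tiling) (x : chamber T) (I : {set 'I_3}) : set plane :=
  draw x @` [set p | triangle p /\ forall i, i \in I -> p 0 i = 0].

Definition source_point (T : tiling) (d : chamber_system T) : plane :=
  draw d.1 (corner (source_type d)).

Definition act_chamber (G : plane_graph) (g : G -> G) (x : chamber G) :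
  chamber G := (g x.1, x.2).

Definition act_cdart (G : plane_graph) (g : G -> G) (d : chamber_system G) :
  chamber_system G := (act_chamber g d.1, d.2).

(* The map [f] of the plane is a symmetry of [T], and [g] is the (unique)
   automorphism it induces. *)
Definition symmetry_inducing (T : tiling) (f : plane -> plane) (g : T -> T) :=
  is_isomorphism g /\
  forall x I, f @` cell x I = cell (act_chamber g x) I.

(* [rho0] and [rho2] are determined by the triple (T, v0, v2). *)
Record lopsp := Lopsp {
  ltiling :> tiling;
  v0 : plane;
  v2 : plane;
  v0_neq_v2 : v0 <> v2;
  rho0 : ltiling -> ltiling;
  rho2 : ltiling -> ltiling;
  rho0P : symmetry_inducing (rotation v0 (pi *+ 2 / 3)) rho0;
  rho2P : symmetry_inducing (rotation v2 (pi / 3)) rho2 }.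

Definition v1 (L : lopsp) : plane :=
  let w := rotation (v2 L) (pi / 3) (v0 L) in
  (((v0 L).1 + w.1) / 2, ((v0 L).2 + w.2) / 2).

Lemma v1P (L : lopsp) (z : plane) :
  rotation (v2 L) (pi / 3) (rotation (v0 L) (pi *+ 2 / 3) z) =
  rotation (v1 L) pi z.
Proof.
have e3 : (pi / 3 + pi *+ 2 / 3 : R) = pi by field.
have c3 : cos (pi / 3) * cos (pi *+ 2 / 3) -
  sin (pi / 3) * sin (pi *+ 2 / 3) = -1 :> R by rewrite -cosD e3 cospi.
have s3 : sin (pi / 3) * cos (pi *+ 2 / 3) +
  cos (pi / 3) * sin (pi *+ 2 / 3) = 0 :> R by rewrite -sinD e3 sinpi.
rewrite /rotation /v1 /= cospi sinpi /rotation /=.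
move: (cos (pi / 3)) (sin (pi / 3)) (cos (pi *+ 2 / 3)) (sin (pi *+ 2 / 3))
  c3 s3 => c s c' s' c3 s3.
case: z (v0 L) (v2 L) => [x y] [a b] [a' b'] /=.
congr pair.
- transitivity (a' + c * (a - a') + s * (b - b') +
    (c * c' - s * s') * (x - a) + (s * c' + c * s') * (y - b)); first by ring.
  by rewrite c3 s3; field.
- transitivity (b' + c * (b - b') - s * (a - a') +
    (c * c' - s * s') * (y - b) - (s * c' + c * s') * (x - a)); first by ring.
  by rewrite c3 s3; field.
Qed.

Section Decoration.
Variable L : lopsp.
Local Notation CT := (chamber_system L).

(* [same_orbit d] is the orbit of [d] under the group generated by the two
   rotations; the last two constructors are the action of their inverses. *)
Inductive same_orbit (d : CT) : CT -> Prop :=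
  | orbit_refl : same_orbit d d
  | orbit_rho0 d' : same_orbit d d' -> same_orbit d (act_cdart (@rho0 L) d')
  | orbit_rho2 d' : same_orbit d d' -> same_orbit d (act_cdart (@rho2 L) d')
  | orbit_rho0V d' : same_orbit d (act_cdart (@rho0 L) d') -> same_orbit d d'
  | orbit_rho2V d' : same_orbit d (act_cdart (@rho2 L) d') -> same_orbit d d'.

Definition orbit_rel (d d' : CT) : bool := `[< same_orbit d d' >].

Lemma same_orbit_trans d d' d'' :
  same_orbit d d' -> same_orbit d' d'' -> same_orbit d d''.
Proof.
move=> dd'; elim=> // {}d'' _.
- exact: orbit_rho0.
- exact: orbit_rho2.
- exact: orbit_rho0V.
- exact: orbit_rho2V.
Qed.

Lemma same_orbit_sym d d' : same_orbit d d' -> same_orbit d' d.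
Proof.
elim=> [|{}d' _|{}d' _|{}d' _|{}d' _]; first exact: orbit_refl.
- by apply: same_orbit_trans; apply/orbit_rho0V/orbit_refl.
- by apply: same_orbit_trans; apply/orbit_rho2V/orbit_refl.
- by apply: same_orbit_trans; apply/orbit_rho0/orbit_refl.
- by apply: same_orbit_trans; apply/orbit_rho2/orbit_refl.
Qed.

Lemma orbit_rel_refl : reflexive orbit_rel.
Proof. by move=> d; apply/asboolP/orbit_refl. Qed.
Lemma orbit_rel_sym : symmetric orbit_rel.
Proof. by move=> d d'; apply/asboolP/asboolP; apply: same_orbit_sym. Qed.
Lemma orbit_rel_trans : transitive orbit_rel.
Proof.
by move=> d' d d'' /asboolP h /asboolP h'; apply/asboolP/(same_orbit_trans h h').
Qed.

Canonical orbit_equiv :=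
  EquivRel orbit_rel orbit_rel_refl orbit_rel_sym orbit_rel_trans.

Local Notation quot := {eq_quot orbit_equiv}.
Definition ddart : choiceType := quot.

Definition orbit_of (d : CT) : ddart := \pi_quot d.
Definition representative (e : ddart) : CT := repr (e : quot).

Lemma representativeK : cancel representative orbit_of.
Proof. by move=> e; apply: reprK. Qed.

Lemma orbit_ofP (d d' : CT) : orbit_of d = orbit_of d' <-> same_orbit d d'.
Proof. by split=> [/eqmodP/asboolP|h] //; apply/eqmodP/asboolP. Qed.

Definition dsigma (e : ddart) : ddart := orbit_of (sigma (representative e)).
Definition dsigmaV (e : ddart) : ddart := orbit_of (sigmaV (representative e)).
Definition dtheta (e : ddart) : ddart := orbit_of (theta (representative e)).

Lemma same_orbit_repr (d : CT) : same_orbit (representative (orbit_of d)) d.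
Proof. by apply/orbit_ofP; rewrite representativeK. Qed.

Lemma same_orbit_morph (f : CT -> CT) :
  (forall g : L -> L, is_isomorphism g ->
    forall d, f (act_cdart g d) = act_cdart g (f d)) ->
  forall d d', same_orbit d d' -> same_orbit (f d) (f d').
Proof.
move=> fM d d'.
have [i0 _] := rho0P L; have [i2 _] := rho2P L.
elim=> [|{}d' _|{}d' _|{}d' _|{}d' _]; first exact: orbit_refl.
- by rewrite fM //; apply: orbit_rho0.
- by rewrite fM //; apply: orbit_rho2.
- by rewrite fM //; apply: orbit_rho0V.
- by rewrite fM //; apply: orbit_rho2V.
Qed.

Lemma act_adj (g : L -> L) : is_isomorphism g ->
  forall i (x : chamber L), adj i (act_chamber g x) = act_chamber g (adj i x).
Proof.
case=> _ gs gt.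
have gV e : g (sigmaV e) = sigmaV (g e).
  by apply: (can_inj (@sigmaK L)); rewrite -gs !sigmaVK.
by case=> [[|[|[|i]]] lti] // [e []]; rewrite /adj /act_chamber /= ?(gt, gs, gV).
Qed.

Lemma act_sigma (g : L -> L) : is_isomorphism g ->
  forall d : CT, sigma (act_cdart g d) = act_cdart g (sigma d).
Proof.
move=> ig [x i].
by rewrite /= /csigma /act_cdart /= act_adj.
Qed.

Lemma act_sigmaV (g : L -> L) : is_isomorphism g ->
  forall d : CT, sigmaV (act_cdart g d) = act_cdart g (sigmaV d).
Proof. by move=> ig [x i]; rewrite /= /csigmaV /act_cdart /= act_adj. Qed.

Lemma act_theta (g : L -> L) : is_isomorphism g ->
  forall d : CT, theta (act_cdart g d) = act_cdart g (theta d).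
Proof. by move=> ig [x i]; rewrite /= /ctheta /act_cdart /= act_adj. Qed.

Lemma dsigma_pi (d : CT) : dsigma (orbit_of d) = orbit_of (sigma d).
Proof.
by apply/orbit_ofP/(same_orbit_morph act_sigma)/same_orbit_repr.
Qed.

Lemma dsigmaV_pi (d : CT) : dsigmaV (orbit_of d) = orbit_of (sigmaV d).
Proof.
by apply/orbit_ofP/(same_orbit_morph act_sigmaV)/same_orbit_repr.
Qed.

Lemma dtheta_pi (d : CT) : dtheta (orbit_of d) = orbit_of (theta d).
Proof.
by apply/orbit_ofP/(same_orbit_morph act_theta)/same_orbit_repr.
Qed.

Lemma dsigmaK : cancel dsigma dsigmaV.
Proof. by move=> e; rewrite -[e]representativeK dsigma_pi dsigmaV_pi sigmaK. Qed.
Lemma dsigmaVK : cancel dsigmaV dsigma.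
Proof. by move=> e; rewrite -[e]representativeK dsigmaV_pi dsigma_pi sigmaVK. Qed.
Lemma dthetaK : involutive dtheta.
Proof. by move=> e; rewrite -[e]representativeK !dtheta_pi thetaK. Qed.

Lemma same_orbit_snd d d' : same_orbit d d' -> d'.1.2 = d.1.2.
Proof. by elim. Qed.

Lemma dtheta_free e : dtheta e <> e.
Proof.
rewrite -[e]representativeK dtheta_pi => /orbit_ofP/same_orbit_snd /=.
by rewrite adj_snd; case: (representative e).1.2.
Qed.

Definition decoration : plane_graph :=
  PlaneGraph dsigmaK dsigmaVK dthetaK dtheta_free.

(* The image in the decoration of the vertex of C_T at the point [z], as the
   set of directed edges having it as source. *)
Definition special_vertex (z : plane) : set decoration :=
  [set e | exists2 d : CT, source_point d = z & e = orbit_of d].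

End Decoration.
End Geometry.

Fixpoint walk (D : plane_graph) (a : set D) (p : seq D) (b : set D) : Prop :=
  if p is e :: p' then vertex e = a /\ walk (vertex (theta e)) p' b else a = b.

Definition visited (D : plane_graph) (a : set D) (p : seq D) : seq (set D) :=
  a :: [seq vertex (theta e) | e <- p].

(* The path is [part1 ++ part2], from [a] to [c], cut at [b]; [part2] is
   directed from [b] to [c]. *)
Record simple_path (D : plane_graph) (a b c : set D) := SimplePath {
  part1 : seq D;
  part2 : seq D;
  walk1 : walk a part1 b;
  walk2 : walk b part2 c;
  path_simple : uniq (visited a (part1 ++ part2)) }.

Lemma walk_cat (D : plane_graph) (a b c : set D) p q :
  walk a p b -> walk b q c -> walk a (p ++ q) c.
Proof.
elim: p a => [|e p IHp] a /=; first by move=> ->.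
by case=> -> hp hq; split=> //; apply: IHp.
Qed.

Lemma walk_nth (D : plane_graph) (a b : set D) p e0 i :
  walk a p b -> (i < size p)%N ->
  vertex (nth e0 p i) = nth set0 (visited a p) i /\
  vertex (theta (nth e0 p i)) = nth set0 (visited a p) i.+1.
Proof.
elim: p a i => // e p IHp a [|i] /= [ea hp] //.
by rewrite ltnS => /(IHp _ _ hp) [h1 h2]; split.
Qed.

Lemma simple_no_inverse (D : plane_graph) (a b : set D) p e :
  walk a p b -> uniq (visited a p) -> e \in p -> theta e \in p -> False.
Proof.
move=> hp hu /(nthP e) [i li ei] /(nthP e) [j lj ej].
have [si ti] := walk_nth e hp li; have [sj tj] := walk_nth e hp lj.
have size_v : size (visited a p) = (size p).+1 by rewrite /= size_map.
rewrite ei in si ti; rewrite ej thetaK in sj tj.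
have /eqP : nth set0 (visited a p) i.+1 = nth set0 (visited a p) j.
  by rewrite -ti -sj.
rewrite nth_uniq ?size_v ?ltnS // 1?ltnW // => /eqP ij.
have /eqP : nth set0 (visited a p) j.+1 = nth set0 (visited a p) i.
  by rewrite -tj -si.
rewrite nth_uniq ?size_v ?ltnS // 1?ltnW // => /eqP ji.
by move: (leqnSn i.+1); rewrite {2}ij ji ltnn.
Qed.

(* The double chamber c_e, i.e. the pair of chambers [(e, true)], [(e, false)],
   is identified with the directed edge [e]. *)
Definition double_chamber (G : plane_graph) : choiceType := dart G.

Section DoubleChamberSystem.
Variable G : plane_graph.
Implicit Type c : double_chamber G.

Definition s1 c : double_chamber G := theta c.
Definition s1V c : double_chamber G := theta c.
Definition s2 c : double_chamber G := sigmaV (theta c).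
Definition s2V c : double_chamber G := theta (sigma c).

Lemma s1K : cancel s1 s1V. Proof. exact: thetaK. Qed.
Lemma s1VK : cancel s1V s1. Proof. exact: thetaK. Qed.
Lemma s2K : cancel s2 s2V.
Proof. by move=> c; rewrite /s2 /s2V sigmaVK thetaK. Qed.
Lemma s2VK : cancel s2V s2.
Proof. by move=> c; rewrite /s2 /s2V thetaK sigmaK. Qed.
End DoubleChamberSystem.

Section Application.
Variables (D : plane_graph) (a b c : set D) (P : simple_path a b c).
Variable G : plane_graph.

(* [part2 P] is directed from v0 to v2, hence is P_2' and not P_2. *)
Definition P2 : seq D := [seq theta e | e <- part2 P].
Definition P2' : seq D := part2 P.
Definition P1 : seq D := part1 P.
Definition P1' : seq D := [seq theta e | e <- part1 P].

Definition s_ (e : D) : double_chamber G -> double_chamber G :=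
  if e \in P2 then @s2 G
  else if e \in P1 then @s1V G
  else if e \in P2' then @s2V G
  else if e \in P1' then @s1 G
  else id.

Lemma mem_map_theta (e : D) s :
  (e \in [seq theta e' | e' <- s]) = (theta e \in s).
Proof. by rewrite -[e in LHS]thetaK mem_map //; exact: can_inj (@thetaK D). Qed.

Lemma s_theta e : cancel (s_ e) (s_ (theta e)).
Proof.
have hw := walk_cat (walk1 P) (walk2 P).
have noinv e' := simple_no_inverse (e := e') hw (path_simple P).
have /= /andP [_ /map_uniq] := path_simple P.
rewrite cat_uniq => /and3P [_ /hasPn disj _].
have h11 e' : e' \in part1 P -> (theta e' \in part1 P) = false.
  by move=> h; apply/negP => h'; apply: (noinv e'); rewrite mem_cat ?h ?h'.
have h12 e' : e' \in part1 P -> (theta e' \in part2 P) = false.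
  by move=> h; apply/negP => h'; apply: (noinv e'); rewrite mem_cat ?h ?h' ?orbT.
have h22 e' : e' \in part2 P -> (theta e' \in part2 P) = false.
  by move=> h; apply/negP => h'; apply: (noinv e'); rewrite mem_cat ?h ?h' ?orbT.
have h21 e' : e' \in part2 P -> (theta e' \in part1 P) = false.
  by move=> h; apply/negP => h'; apply: (noinv e'); rewrite mem_cat ?h ?h' ?orbT.
have d e' : e' \in part2 P -> (e' \in part1 P) = false.
  by move=> /disj/negPf.
move=> x; rewrite /s_ /P1 /P1' /P2 /P2' !mem_map_theta thetaK.
have [t2|t2] := boolP (theta e \in part2 P).
  by have := h22 _ t2; rewrite thetaK => ->; rewrite (d _ t2) s2K.
have [e1|e1] := boolP (e \in part1 P).
  have e2 : (e \in part2 P) = false by apply/negP => /d; rewrite e1.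
  by rewrite e2 (h11 _ e1) s1VK.
have [e2|e2] := boolP (e \in part2 P); first by rewrite s2VK.
by have [t1|//] := boolP (theta e \in part1 P); rewrite s1K.
Qed.

Lemma s_thetaV e : cancel (s_ (theta e)) (s_ e).
Proof. by move=> x; have := @s_theta (theta e) x; rewrite thetaK. Qed.

Definition appdart : choiceType := (dart D * double_chamber G)%type.

Definition sigmaP (ec : appdart) : appdart := (sigma ec.1, s_ ec.1 ec.2).
Definition sigmaPV (ec : appdart) : appdart :=
  let e := sigmaV ec.1 in (e, s_ (theta e) ec.2).
Definition thetaP (ec : appdart) : appdart := (theta ec.1, s_ ec.1 ec.2).

Lemma sigmaPK : cancel sigmaP sigmaPV.
Proof. by case=> e x; rewrite /sigmaP /sigmaPV /= sigmaK s_theta. Qed.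
Lemma sigmaPVK : cancel sigmaPV sigmaP.
Proof. by case=> e x; rewrite /sigmaP /sigmaPV /= sigmaVK s_thetaV. Qed.
Lemma thetaPK : involutive thetaP.
Proof. by case=> e x; rewrite /thetaP /= thetaK s_theta. Qed.
Lemma thetaP_free ec : thetaP ec <> ec.
Proof. by case: ec => e x [] /theta_free. Qed.

Definition application : plane_graph :=
  PlaneGraph sigmaPK sigmaPVK thetaPK thetaP_free.
End Application.

Definition lopsp_path (R : realType) (L : lopsp R) : Type :=
  @simple_path (decoration L)
    (special_vertex (v1 L)) (special_vertex (v0 L)) (special_vertex (v2 L)).

(* Main.v *)
Require Import Defs.
From HB Require Import structures.
From mathcomp Require Import all_boot all_order all_algebra.
From mathcomp Require Import all_classical all_reals all_analysis.
From mathcomp Require Import zify lra.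

Set Implicit Arguments.
Unset Strict Implicit.
Unset Printing Implicit Defensive.

(** Crossing an edge [e] of the decoration [D] acts on the double chambers of
    [G] by the permutation s_(P,e), and the faces of D_P(G) lie over the faces
    of [D].  So D_P(G) is the covering of [D], branched at the special
    vertices, that is described by the labels s_(P,e).  A map
    (e, c) |-> (e, g_e c) is an isomorphism from D_P(G) to D_Q(G) as soon as
    [g] is constant on the faces of [D] and turns one labelling into the
    other: the two labellings have to be gauge equivalent.  The labels are
    taken in the free product <a, b | a^2 = 1>, which acts on the double
    chambers of every [G] by a |-> s1 and b |-> s2, and the gauge equivalence
    is found there ([labels_gauge_equivalent]).

    Two properties of [D] enter.  Its vertices have finite degree, and it is a
    sphere in the following weak sense: a set of edges that meets every vertex
    evenly separates the faces into two sides ([even_sets_separate]).  This is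
    proved for the tiling first, where it says that a double covering of the
    plane is trivial: a section over a rectangle is glued from sections over
    small pieces of it ([section_box], [local_potentials_glue]).  It
    passes to the quotient because each of the two rotations that generate the
    symmetry group has a fixed point, and turning round this point does not
    exchange the two sides ([potential_invariant]).

    Start from the labelling given by [Q].  Its holonomy round every vertex but
    the special ones is trivial.  Consider the edges that lie on [P] or carry
    a nontrivial label.  If such an edge off [P] is on a cycle of such edges,
    the cycle separates, and multiplying by a constant on one side makes the
    label of that edge trivial without creating a new nontrivial label off [P]
    ([kill_edge]).  If no such edge is on a cycle, they form trees attached to
    [P], and a leaf would be a vertex with nontrivial holonomy
    ([bridges_impossible]).  Hence all labels can be concentrated on [P]
    ([concentrate_on_path]).

    Trivial holonomy at the inner vertices of [P] then makes the labels
    constant on each of its two halves.  Up to conjugation the holonomies at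
    v1, v2 and v0 do not change with the gauge; comparing them for the two
    paths shows that the two constants are conjugate to those of [P], and that
    a product of them is conjugate to the corresponding product
    ([value_start], [value_end], [value_middle]).  In <a, b | a^2 = 1> this
    forces the two pairs to be conjugate by a single element ([conj_pair]), and
    a constant change of gauge finishes the proof. *)

(** * The free product of a group of order two and an infinite cyclic group *)

(** [None] is the generator of order two, [Some true] the generator of infinite
    order and [Some false] its inverse. *)
Definition letter := option bool.
Definition flip : letter -> letter := omap negb.
Lemma flipK : involutive flip. Proof. by case=> [[]|]. Qed.

Definition noncancelling : rel letter := fun x y => y != flip x.
Definition reduced (w : seq letter) := sorted noncancelling w.

Definition push (x : letter) (w : seq letter) :=
  if w is y :: w' then if y == flip x then w' else x :: w else [:: x].
Definition normalize (w : seq letter) := foldr push [::] w.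
Definition inverse_word (w : seq letter) := rev (map flip w).

Lemma reduced_push x w : reduced w -> reduced (push x w).
Proof.
case: w => //= y w; case: eqP => [_|/eqP ne] /=; first exact: path_sorted.
by move=> ->; rewrite andbT.
Qed.

Lemma push_flip x w : reduced w -> push (flip x) (push x w) = w.
Proof.
case: w => [|y w] /=; first by rewrite flipK eqxx.
case: eqP => [->|_] /=; last by rewrite flipK eqxx.
case: w => //= z w /andP[]; rewrite /noncancelling flipK => /negPf -> _.
by [].
Qed.

Lemma push_flipV x w : reduced w -> push x (push (flip x) w) = w.
Proof. by move=> rw; rewrite -{1}[x]flipK push_flip. Qed.

Lemma foldr_push_reduced u w : reduced w -> reduced (foldr push w u).
Proof. by move=> rw; elim: u => //= x u IHu; exact: reduced_push. Qed.

Lemma normalize_reduced w : reduced (normalize w).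
Proof. exact: foldr_push_reduced. Qed.

Lemma normalize_id w : reduced w -> normalize w = w.
Proof.
elim: w => //= x w IHw rw; rewrite /normalize /= -/(normalize w) IHw.
  by case: w rw {IHw} => //= y w /andP[/negPf ->].
exact: path_sorted rw.
Qed.

Lemma size_normalize w : size (normalize w) <= size w.
Proof.
elim: w => //= x w IHw; rewrite /normalize /= -/(normalize w).
case: (normalize w) IHw => //= y w' IHw; case: eqP => _ //=.
by apply: leq_trans (leqW IHw).
Qed.

(** [foldr push w] is an action of words on reduced words in which opposite
    letters act by inverse maps ([push_flip]); so it only sees the group
    element, which gives associativity of the product. *)
Lemma foldr_push_normalize u w : reduced w ->
  foldr push w (normalize u) = foldr push w u.
Proof.
move=> rw; elim: u => //= x u <-; rewrite /normalize /= -/(normalize u).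
case: (normalize u) => //= y u'; case: eqP => [->|_] //=.
by rewrite push_flipV // foldr_push_reduced.
Qed.

Lemma normalize_catl u v : normalize (normalize u ++ v) = normalize (u ++ v).
Proof.
rewrite /normalize !foldr_cat; apply: foldr_push_normalize.
exact: normalize_reduced.
Qed.

Lemma normalize_catr u v : normalize (u ++ normalize v) = normalize (u ++ v).
Proof.
by rewrite {1 3}/normalize !foldr_cat [foldr _ _ (normalize v)]normalize_id //
  normalize_reduced.
Qed.

Lemma normalize_invl w : normalize (inverse_word w ++ w) = [::].
Proof.
suff H u : reduced u -> foldr push (foldr push u w) (inverse_word w) = u.
  by rewrite /normalize foldr_cat; exact: H.
elim: w u => //= x w IHw u ru; rewrite /inverse_word /= rev_cons foldr_rcons.
by rewrite push_flip ?IHw // foldr_push_reduced.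
Qed.

Lemma inverse_wordK : involutive inverse_word.
Proof.
by move=> w; rewrite /inverse_word map_rev revK mapK //; exact: flipK.
Qed.

Lemma reduced_inverse w : reduced w -> reduced (inverse_word w).
Proof.
rewrite /reduced rev_sorted sorted_map; apply: sub_sorted => x y.
by rewrite /noncancelling /= flipK eq_sym.
Qed.

Lemma reduced_cat x s y t : reduced ((x :: s) ++ (y :: t)) =
  [&& reduced (x :: s), noncancelling (last x s) y & reduced (y :: t)].
Proof. by rewrite /reduced /= cat_path. Qed.

(** The elements are the normal forms themselves: the proof of [conj_pair] is a
    count of letters. *)
Record Z2freeZ := ReducedWord {
  word : seq letter;
  word_reduced : reduced word }.
HB.instance Definition _ := [isSub for word].
HB.instance Definition _ := [Choice of Z2freeZ by <:].

Definition of_word w := ReducedWord (normalize_reduced w).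
Definition Z2freeZ_mul (x y : Z2freeZ) := of_word (word x ++ word y).
Definition Z2freeZ_inv (x : Z2freeZ) := of_word (inverse_word (word x)).

Lemma of_wordK x : of_word (word x) = x.
Proof. by apply: val_inj; rewrite /= normalize_id // word_reduced. Qed.

Lemma Z2freeZ_mulA : associative Z2freeZ_mul.
Proof.
move=> x y z; apply: val_inj.
by rewrite /= normalize_catr normalize_catl catA.
Qed.
Lemma Z2freeZ_mul1g : left_id (of_word [::]) Z2freeZ_mul.
Proof. by move=> x; rewrite /Z2freeZ_mul /= of_wordK. Qed.
Lemma Z2freeZ_mulg1 : right_id (of_word [::]) Z2freeZ_mul.
Proof. by move=> x; rewrite /Z2freeZ_mul /= cats0 of_wordK. Qed.
Lemma Z2freeZ_mulVg : left_inverse (of_word [::]) Z2freeZ_inv Z2freeZ_mul.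
Proof.
by move=> x; apply: val_inj; rewrite /= normalize_catl normalize_invl.
Qed.
Lemma Z2freeZ_mulgV : right_inverse (of_word [::]) Z2freeZ_inv Z2freeZ_mul.
Proof.
move=> x; apply: val_inj; rewrite /= normalize_catr.
by rewrite -{1}[word x]inverse_wordK normalize_invl.
Qed.

HB.instance Definition _ := isGroup.Build Z2freeZ
  Z2freeZ_mulA Z2freeZ_mul1g Z2freeZ_mulg1 Z2freeZ_mulVg Z2freeZ_mulgV.

Local Open Scope group_scope.

Lemma of_word_cat u v : of_word (u ++ v) = of_word u * of_word v.
Proof. by apply: val_inj; rewrite /= normalize_catr normalize_catl. Qed.

Lemma of_word_inv u : of_word (inverse_word u) = (of_word u)^-1.
Proof.
apply: (mulIg (of_word u)); rewrite mulVg -of_word_cat.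
by apply: val_inj; rewrite /= normalize_invl.
Qed.

Lemma of_word_exp u n : of_word u ^+ n = of_word (flatten (nseq n u)).
Proof. by elim: n => // n IHn; rewrite expgS IHn -of_word_cat. Qed.

(** All powers of [u] are reduced, so the n-th power has n * size u letters,
    whereas the n-th power of a conjugate of [v] can be written with
    n * size v letters and a bounded number of further ones. *)
Lemma cyclically_reduced_minimal u v z :
  reduced (u ++ u) -> of_word u = of_word v ^ z -> size u <= size v.
Proof.
move=> ru e.
have ru_n n : reduced (flatten (nseq n u)).
  case: u ru {e} => [|x u] /=; first by elim: n.
  rewrite /reduced /= cat_path => /andP[xu uxu]; case: n => //= n.
  rewrite cat_path xu /=; elim: n => //= n IHn.
  by move: uxu => /= /andP[-> _]; rewrite cat_path xu.
have size_n n (w : seq letter) : size (flatten (nseq n w)) = (n * size w)%N.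
  by elim: n => //= n IHn; rewrite size_cat IHn mulSn.
(* The conjugating element adds at most 2 * size (word z) letters. *)
have [n nE] : exists n, n = (2 * size (word z)).+1 by eexists.
have := congr1 (fun g => size (word (g ^+ n))) e.
rewrite -conjXg !of_word_exp [LHS]/= normalize_id // size_n conjgE.
rewrite -{1 2}[z]of_wordK -of_word_inv -!of_word_cat /=.
set s := size (normalize _) => es.
have : (s <= 2 * size (word z) + n * size v)%N.
  apply: leq_trans (size_normalize _) _.
  have := size_normalize (flatten (nseq n v)).
  have := size_normalize (word z).
  by rewrite !size_cat size_rev size_map size_n; lia.
rewrite -es nE; nia.
Qed.

Definition gen_a := of_word [:: None].
Definition gen_b := of_word [:: Some true].

Lemma of_word_letter_b e : of_word [:: Some e] = if e then gen_b else gen_b^-1.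
Proof. by case: e => //; rewrite -of_word_inv. Qed.

(** Induction on the length of [w].  A first letter a of [w] disappears from
    a^w, and a last letter b or b^-1 of [w] can be moved into the conjugators
    on both sides.  If [w] admits neither reduction, the word w^-1 a w b is
    cyclically reduced and longer than a b, so it cannot be conjugate to a b. *)
Lemma conj_pair_aux n w z : (size (word w) <= n)%N ->
  gen_a ^ w * gen_b = (gen_a * gen_b) ^ z ->
  exists2 h, gen_a ^ w = gen_a ^ h & gen_b ^ h = gen_b.
Proof.
elim: n w z => [|n IHn] w z.
  rewrite leqn0 => /nilP w0 _.
  by exists 1; rewrite ?conjg1 // -[w]of_wordK w0 conjg1.
have rw := word_reduced w.
have aa : gen_a * gen_a = 1 by apply: val_inj.
case Ew: (word w) => [|[e|] w'] /= sw E.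
- by exists 1; rewrite ?conjg1 // -[w]of_wordK Ew conjg1.
- case/lastP: w' Ew sw => [|w1 l] Ew sw.
    have we : of_word [:: Some e] = w by rewrite -Ew of_wordK.
    have wb : gen_b ^ w = gen_b.
      by rewrite -we of_word_letter_b; case: (e); rewrite conjgE !gnorm.
    by exists w.
  have ww : w = of_word (Some e :: w1) * of_word [:: l].
    by rewrite -of_word_cat cats1 rcons_cons -Ew of_wordK.
  case: l ww Ew sw => [e'|] ww Ew sw.
    pose g := of_word [:: Some e']; pose w2 := of_word (Some e :: w1).
    have gb : gen_b ^ g = gen_b.
      by rewrite /g of_word_letter_b; case: (e'); rewrite conjgE !gnorm.
    have gb' : gen_b ^ g^-1 = gen_b by rewrite -{1}gb conjgK.
    have [||h h1 h2] := IHn w2 (z * g^-1).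
    - apply: leq_trans (size_normalize _) _.
      by rewrite /= -ltnS; move: sw; rewrite size_rcons.
    - rewrite conjgM -E conjMg gb' ww -conjgM mulgK //.
    exists (h * g); last by rewrite conjgM h2.
    by rewrite ww !conjgM -/w2 h1.
  pose u := inverse_word (word w) ++ None :: word w ++ [:: Some true].
  have : (size u <= size [:: None; Some true])%N.
    apply: (@cyclically_reduced_minimal _ _ z).
      have ri := reduced_inverse rw.
      have uE : u = None :: (rev (map flip w1) ++ [:: flip (Some e)]) ++
          None :: (Some e :: rcons w1 None) ++ [:: Some true].
        by rewrite /u Ew /inverse_word /= rev_cons map_rcons rev_rcons -cats1.
      have ri' : reduced (None :: (rev (map flip w1) ++ [:: flip (Some e)])).
        move: ri; rewrite Ew /inverse_word /= rev_cons map_rcons rev_rcons.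
        by rewrite -cats1.
      have ru : reduced u.
        rewrite uE -cat_cons reduced_cat ri' last_cat /=.
        by move: rw; rewrite Ew /reduced /= cat_path last_rcons /= => ->.
      have lu : last None (behead u) = Some true.
        by rewrite uE /= !last_cat /= last_cat.
      have u1 : u = None :: behead u by rewrite uE.
      by rewrite u1 reduced_cat lu -u1 ru.
    rewrite /u -[[:: None; _]]cat1s !of_word_cat -cat1s !of_word_cat.
    by rewrite of_word_inv of_wordK -/gen_a -/gen_b -E conjgE !mulgA.
  by rewrite /u !size_cat /= size_cat Ew /= size_rcons; lia.
have ww : w = gen_a * of_word w'.
  by rewrite -of_word_cat -[_ ++ _]/(None :: w') -Ew of_wordK.
have Ea : gen_a ^ w = gen_a ^ of_word w'.
  by rewrite ww conjgM [gen_a ^ gen_a]conjgE aa mulg1 -(mulg1_eq aa).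
rewrite Ea; apply: (IHn _ z); last by rewrite -Ea.
exact: leq_trans (size_normalize _) sw.
Qed.

(** Conjugation by y^-1 reduces this to the case be = b. *)
Lemma conj_pair (al be x y z : Z2freeZ) :
  al = gen_a ^ x -> be = gen_b ^ y -> al * be = (gen_a * gen_b) ^ z ->
  exists h, al = gen_a ^ h /\ be = gen_b ^ h.
Proof.
move=> ea eb; rewrite {}ea {}eb => eab.
have [|h h1 h2] := @conj_pair_aux _ (x * y^-1) (z * y^-1) (leqnn _).
  by rewrite !conjgM -eab [RHS]conjMg (conjgK y).
exists (h * y); rewrite !conjgM h2 -h1 -conjgM mulgVK //.
Qed.

Local Open Scope classical_set_scope.
Local Open Scope group_scope.

(** * Vertices, holonomy and gauge *)

Definition finite_degrees (D : plane_graph) :=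
  forall d : D, exists2 n, (0 < n)%N & iter n (@sigma D) d = d.

(** [z] is a set of edges.  At a vertex of finite degree a function [phi] as
    below exists if and only if the number of darts of [z] at the vertex is
    even.  As f (sigma d) = f (theta d), the function [f] is a colouring of the
    faces by two colours, and the colours on both sides of an edge differ
    exactly if the edge is in [z]. *)
Definition even_sets_separate (D : plane_graph) :=
  forall z phi : D -> bool,
  (forall d, z (theta d) = z d) -> (forall d, phi (sigma d) = phi d (+) z d) ->
  exists f : D -> bool, forall d,
    f (sigma d) = f d (+) z d /\ f (theta d) = f d (+) z d.

Section Vertices.
Variable D : plane_graph.
Implicit Types (d e : D).

Lemma theta_eq d e : (theta d == e) = (d == theta e).
Proof. exact: can2_eq (@thetaK D) (@thetaK D) d e. Qed.

Lemma iter_sigma_inj n : injective (iter n (@sigma D)).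
Proof. by elim: n => // n IHn x y /= /(can_inj (@sigmaK D)) /IHn. Qed.

Lemma vertex_refl e : vertex e e.
Proof. by exists 0%N; left. Qed.

Lemma vertex_iter n e : vertex (iter n (@sigma D) e) = vertex e.
Proof.
elim: n => //= n <-; move: (iter n _ e) => {}e.
apply/seteqP; split=> d [m [->|E]].
- by exists m.+1; left; rewrite iterSr.
- case: m E => [|m] E; first by exists 1%N; left; exact: esym E.
  exists m; right; apply: (can_inj (@sigmaK D)); by rewrite E.
- case: m => [|m]; first by exists 1%N; right.
  by exists m; left; rewrite iterSr.
- by exists m.+1; right; rewrite iterS -E.
Qed.

Definition is_degree n e := [/\ (0 < n)%N, iter n (@sigma D) e = e &
  forall i, (0 < i < n)%N -> iter i (@sigma D) e <> e].

Lemma degree_exists e : finite_degrees D -> exists n, is_degree n e.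
Proof.
move=> fin; have [n n0 ne] := fin e.
have ex : exists n, (0 < n)%N && (iter n (@sigma D) e == e).
  by exists n; rewrite n0 ne eqxx.
case: (ex_minnP ex) => m /andP[m0 /eqP me] mmin; exists m; split=> //.
move=> i /andP[i0 im] ie; have := mmin i; rewrite i0 ie eqxx => /(_ isT).
by rewrite leqNgt im.
Qed.

Lemma vertex_degree n e d : is_degree n e -> vertex d = vertex e ->
  exists2 i, (i < n)%N & d = iter i (@sigma D) e.
Proof.
move=> [n0 ne _] de; have : vertex e d by rewrite -de; exact: vertex_refl.
have per k : iter (k * n) (@sigma D) e = e.
  by elim: k => // k IHk; rewrite mulSn iterD IHk.
case=> m [->|E].
  exists (m %% n)%N; first by rewrite ltn_mod.
  by rewrite {1}(divn_eq m n) addnC iterD per.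
have mm : (m <= m * n)%N by rewrite leq_pmulr.
exists ((m * n - m) %% n)%N; first by rewrite ltn_mod.
apply: (@iter_sigma_inj m); rewrite -E -iterD.
rewrite -{1}(per m) -{1}(subnKC mm) {1}(divn_eq (m * n - m) n).
by rewrite [(_ %/ n * n + _)%N]addnC addnA iterD per.
Qed.

Lemma is_degree_vertex n e d : is_degree n e -> vertex d = vertex e ->
  is_degree n d.
Proof.
move=> deg de; have [k _ ->] := vertex_degree deg de; case: deg => n0 ne nmin.
split=> // [|i /nmin ine]; rewrite -iterD addnC iterD ?ne //.
by move=> /iter_sigma_inj.
Qed.

End Vertices.

Section Gauge.
Variables (D : plane_graph) (H : groupType).
Implicit Types (d e : D) (u v w g : D -> H).

Definition cocycle u := forall e, u (theta e) = (u e)^-1.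
(** The faces are the orbits of sigma o theta, so [g] is constant on faces. *)
Definition facewise g := forall e, g (sigma e) = g (theta e).
Definition regauge g u e := g (theta e) * u e * (g e)^-1.

(** The labels met while turning round the source of [e], later ones on the
    left: this is how the maps s_(P,e) are composed by iterating sigma_P. *)
Fixpoint holonomy u n e : H :=
  if n is n'.+1 then u (iter n' (@sigma D) e) * holonomy u n' e else 1.

Definition flat u e := forall n, is_degree n e -> holonomy u n e = 1.

(** As [g] is constant on faces, its values telescope. *)
Lemma holonomy_regauge g u n e : facewise g ->
  holonomy (regauge g u) n e =
    g (iter n (@sigma D) e) * holonomy u n e * (g e)^-1.
Proof.
move=> fg; elim: n => [|n IHn] /=; first by rewrite mulg1 mulgV.
by rewrite IHn /regauge fg !mulgA mulgVK.
Qed.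

Lemma holonomy_add u m n e :
  holonomy u (m + n) e = holonomy u m (iter n (@sigma D) e) * holonomy u n e.
Proof.
by elim: m => [|m IHm] /=; rewrite ?mul1g // IHm mulgA iterD.
Qed.

(** Around a full turn a gauge change is a conjugation, and so is a change of
    the starting dart. *)
Lemma holonomy_conj g u e d n :
  facewise g -> is_degree n e -> vertex d = vertex e ->
  exists k, holonomy (regauge g u) n e = holonomy u n d ^ k.
Proof.
move=> fg deg de; have [i _ ->] := vertex_degree deg de.
exists (holonomy u i e * (g e)^-1); case: deg => _ ne _.
rewrite holonomy_regauge // ne conjgM conjgE invgK -mulgA; congr (_ * (_ * _)).
by rewrite conjgE -holonomy_add addnC holonomy_add ne mulKg.
Qed.

Lemma regauge_cocycle g u : cocycle u -> cocycle (regauge g u).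
Proof.
by move=> cu e; rewrite /regauge thetaK cu !invgM invgK mulgA.
Qed.

Lemma regauge_comp g g' u e :
  regauge g' (regauge g u) e = regauge (fun d => g' d * g d) u e.
Proof. by rewrite /regauge invgM !mulgA. Qed.

Lemma regauge_flat g u e : facewise g -> flat u e -> flat (regauge g u) e.
Proof.
move=> fg fu n deg; rewrite holonomy_regauge // fu //; case: deg => _ -> _.
by rewrite mulg1 mulgV.
Qed.

Lemma holonomy1 u n e : (forall i, (i < n)%N -> u (iter i (@sigma D) e) = 1) ->
  holonomy u n e = 1.
Proof.
elim: n => //= n IHn h; rewrite h // mul1g IHn // => i ni.
by apply: h; rewrite ltnW.
Qed.

Lemma holonomy_single u n e : is_degree n e ->
  (forall d, vertex d = vertex e -> u d != 1 -> d = e) -> holonomy u n e = u e.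
Proof.
case=> n0 ne nmin h; rewrite -(prednK n0) -[n.-1.+1]addn1 holonomy_add /= mulg1.
rewrite holonomy1 ?mul1g // => i ni; apply/eqP/negPn/negP => /h.
rewrite -iterSr vertex_iter => /(_ erefl); apply: nmin.
by rewrite /= -(prednK n0) ltnS.
Qed.

Lemma holonomy_pair u n e e' :
  is_degree n e -> vertex e' = vertex e -> e' <> e ->
  (forall d, vertex d = vertex e -> u d != 1 -> d = e \/ d = e') ->
  holonomy u n e = u e' * u e.
Proof.
move=> deg vee' ne' h; have [i ni Ei] := vertex_degree deg vee'.
have i0 : (0 < i)%N by rewrite lt0n; apply/eqP => i0; apply: ne'; rewrite Ei i0.
case: (deg) => n0 ne nmin.
have triv j : (0 < j < n)%N -> j != i -> u (iter j (@sigma D) e) = 1.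
  move=> j0n ji; apply/eqP/negPn/negP => /h.
  rewrite vertex_iter => /(_ erefl) [/(nmin _ j0n)//|].
  have /andP[_ jn] := j0n.
  rewrite Ei => Eij.
  have [lt|lt|eq] := ltngtP i j; last by rewrite eq eqxx in ji.
    move: Eij; rewrite -(subnKC (ltnW lt)) iterD => /iter_sigma_inj.
    by apply: nmin; lia.
  move: Eij; rewrite -(subnKC (ltnW lt)) iterD => /iter_sigma_inj /esym.
  by apply: nmin; lia.
rewrite (_ : n = (n - i.+1) + (1 + (i.-1 + 1)))%N; last by lia.
have h1 d : holonomy u 1 d = u d by rewrite /= mulg1.
rewrite !holonomy_add !h1.
rewrite holonomy1 ?mul1g => [|j jn]; last by rewrite -iterD triv //; lia.
rewrite (_ : (i.-1 + 1 = i)%N) -?Ei; last by lia.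
congr (_ * _); rewrite holonomy1 ?mul1g // => j jn.
by rewrite -(@iterSr _ j) triv //; lia.
Qed.

End Gauge.

(** * Concentrating the labels on a path *)

Lemma sub_count_lt (T : eqType) (a b : pred T) (s : seq T) x :
  subpred a b -> x \in s -> b x -> ~~ a x -> (count a s < count b s)%N.
Proof.
move=> ab; elim: s => //= y s IHs; rewrite inE => /orP[/eqP <-|xs] bx ax.
  by rewrite bx (negPf ax) add0n add1n ltnS sub_count.
have := IHs xs bx ax; have : (a y <= b y)%N by case: (a y) (ab y) => // ->.
lia.
Qed.

Section Connection.
Variable D : plane_graph.
Implicit Types (d e : D) (N : pred D).

(** [e] and [e'] start in the same component of the subgraph with edge set [N].
    Quantifying over all invariant predicates gives the equivalence relation
    generated by the steps without handling inverse steps. *)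
Variant joined N e e' : Prop := Joined of forall A : D -> Prop,
  (forall d, A d <-> A (sigma d)) -> (forall d, N d -> (A d <-> A (theta d))) ->
  A e -> A e'.

Lemma joined_elim N e e' (A : D -> Prop) : joined N e e' ->
  (forall d, A d <-> A (sigma d)) -> (forall d, N d -> (A d <-> A (theta d))) ->
  A e -> A e'.
Proof. by case; apply. Qed.

Lemma joined_refl N e : joined N e e. Proof. by constructor. Qed.

Lemma joined_trans N e e' e'' :
  joined N e e' -> joined N e' e'' -> joined N e e''.
Proof. by case=> h1 [h2]; constructor=> A As At /(h1 A As At); exact: h2. Qed.

Lemma joined_sym N e e' : joined N e e' -> joined N e' e.
Proof.
case=> h; constructor=> A As At Ae'; apply: contrapT => nAe.
apply: (h (fun d => ~ A d)) nAe Ae'.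
  by move=> d; have := As d; tauto.
by move=> d /At; tauto.
Qed.

Lemma joined_theta N e : N e -> joined N e (theta e).
Proof. by move=> Ne; constructor=> A _ /(_ e Ne) [+ _]. Qed.

Lemma joined_sigma N e : joined N e (sigma e).
Proof. by constructor=> A /(_ e) [+ _]. Qed.

Lemma joined_vertex N e e' : vertex e = vertex e' -> joined N e e'.
Proof.
move=> h; have it n d : joined N d (iter n (@sigma D) d).
  elim: n => [|n IHn]; first exact: joined_refl.
  exact: joined_trans IHn (joined_sigma _ _).
have : vertex e' e by rewrite -h; exact: vertex_refl.
by case=> n [->|->]; [apply: joined_sym|]; exact: it.
Qed.

(** [z] counts modulo 2 how often a walk from [e] to [e'] uses an edge.  Every
    passage through a vertex contributes two darts, so [z] is even at each
    vertex except for the defect at the two ends.  Counting modulo 2 spares the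
    extraction of a simple walk. *)
Lemma joined_chain N e e' : joined N e e' ->
  exists z phi : D -> bool,
    [/\ forall d, z (theta d) = z d,
        forall d, z d -> N d || N (theta d) &
        forall d, phi (sigma d) = phi d (+) z d (+) ((d == e) (+) (d == e'))].
Proof.
move=> h; apply: (@joined_elim _ _ _ (fun e' => exists z phi : D -> bool,
    [/\ forall d, z (theta d) = z d, forall d, z d -> N d || N (theta d) &
        forall d, phi (sigma d) = phi d (+) z d (+) ((d == e) (+) (d == e'))])
  h) => [d|d Nd|].
- split=> [[z [phi [zt zN ps]]]|[z [phi [zt zN ps]]]].
    exists z, (fun x => phi x (+) (x == sigma d)); split=> // x.
    rewrite ps (can_eq (@sigmaK D)).
    by case: (phi x) (z x) (x == e) (x == d) (x == sigma d) =>
      [] [] [] [] [].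
  exists z, (fun x => phi x (+) (x == sigma d)); split=> // x.
  rewrite ps (can_eq (@sigmaK D)).
  by case: (phi x) (z x) (x == e) (x == d) (x == sigma d) => [] [] [] [] [].
- have flipz z : (forall x, z (theta x) = z x) ->
      forall x, z (theta x) (+) ((theta x == d) (+) (theta x == theta d)) =
                z x (+) ((x == d) (+) (x == theta d)).
    move=> zt x; rewrite zt (can_eq (@thetaK D)) theta_eq.
    by rewrite [(x == theta d) (+) _]addbC.
  have suppz (z : D -> bool) : (forall x, z x -> N x || N (theta x)) ->
      forall x, z x (+) ((x == d) (+) (x == theta d)) -> N x || N (theta x).
    move=> zN x; case: eqP => [->|_]; first by rewrite Nd.
    by case: eqP => [->|_]; rewrite ?thetaK ?Nd ?orbT //= !addbF; exact: zN.
  split=> [[z [phi [zt zN ps]]]|[z [phi [zt zN ps]]]].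
    exists (fun x => z x (+) ((x == d) (+) (x == theta d))), phi.
    split; [exact: flipz | exact: suppz | move=> x; rewrite ps].
    by case: (phi x) (z x) (x == e) (x == d) (x == theta d) => [] [] [] [] [].
  exists (fun x => z x (+) ((x == d) (+) (x == theta d))), phi.
  split; [exact: flipz | exact: suppz | move=> x; rewrite ps].
  by case: (phi x) (z x) (x == e) (x == d) (x == theta d) => [] [] [] [] [].
- exists (fun=> false), (fun=> false); split=> // d.
  by case: (d == e).
Qed.

Definition edge_of (p : seq D) e := (e \in p) || (theta e \in p).

Lemma edge_of_theta p e : edge_of p (theta e) = edge_of p e.
Proof. by rewrite /edge_of thetaK orbC. Qed.

Lemma walk_joined N a p b : walk a p b -> (forall d, edge_of p d -> N d) ->
  forall d d', edge_of p d -> edge_of p d' -> joined N d d'.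
Proof.
suff H e p' a' : walk a' (e :: p') b ->
    (forall d, edge_of (e :: p') d -> N d) ->
    forall d, edge_of (e :: p') d -> joined N e d.
  case: p => [|e p] // wp Np d d' dp d'p.
  by apply: (joined_trans (e' := e)); [apply: joined_sym|]; exact: (H e p a).
elim: p' e a' => [|e' p' IHp] e a' /= [_ wp] Np d.
  have Ne : N e by apply: Np; rewrite /edge_of mem_head.
  rewrite /edge_of !inE => /orP[/eqP ->|/eqP E]; first exact: joined_refl.
  by rewrite -[d]thetaK E; exact: joined_theta.
have Ne : N e by apply: Np; rewrite /edge_of mem_head.
have [ve' _] := wp.
rewrite /edge_of inE [theta d \in _]inE.
case/orP=> [/orP[/eqP ->|dp]|/orP[/eqP E|dp]].
- exact: joined_refl.
- apply: joined_trans (joined_theta Ne) _.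
  apply: joined_trans (joined_vertex _ (esym ve')) _.
  apply: (IHp _ _ wp) => [x xp|]; last by rewrite /edge_of dp.
  by apply: Np; move: xp; rewrite /edge_of !inE => /orP[->|->]; rewrite !orbT.
- by rewrite -[d]thetaK E; exact: joined_theta.
- apply: joined_trans (joined_theta Ne) _.
  apply: joined_trans (joined_vertex _ (esym ve')) _.
  apply: (IHp _ _ wp) => [x xp|]; last by rewrite /edge_of dp orbT.
  by apply: Np; move: xp; rewrite /edge_of !inE => /orP[->|->]; rewrite !orbT.
Qed.

End Connection.

Section Concentrate.
Variables (D : plane_graph) (H : groupType).
Hypotheses (fin : finite_degrees D) (sep : even_sets_separate D).
Variables (a b : set D) (p : seq D).
Hypothesis wp : walk a p b.
Implicit Types (d e : D) (u : D -> H).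

Definition stray u e := (u e != 1) && ~~ edge_of p e.
Definition used u e := (u e != 1) || edge_of p e.
Definition used_but u e := fun d => [&& used u d, d != e & theta d != e].

(** Nothing is asked at the vertices of [p].  The special vertices, where the
    holonomy is nontrivial, are among them when [p] joins v1 to v2. *)
Definition admissible u :=
  cocycle u /\
  forall e, (forall d, vertex d = vertex e -> ~~ edge_of p d) -> flat u e.

Lemma cocycle_theta_eq1 u e : cocycle u -> (u (theta e) == 1) = (u e == 1).
Proof. by move=> ->; rewrite -[RHS]eqg_inv invg1. Qed.

Lemma stray_theta u e : cocycle u -> stray u (theta e) = stray u e.
Proof.
by move=> cu; rewrite /stray edge_of_theta cocycle_theta_eq1.
Qed.

Lemma used_theta u e : cocycle u -> used u (theta e) = used u e.
Proof. by move=> cu; rewrite /used edge_of_theta cocycle_theta_eq1. Qed.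

(** The edge of [e0] closes up to a cycle of used edges.  On one side of this
    cycle all labels are multiplied by a constant: labels away from the cycle
    are kept or conjugated, and on the cycle the only stray labels are those
    that were stray before, while the one on [e0] is cancelled. *)
Lemma kill_edge u e0 : admissible u -> stray u e0 ->
  joined (used_but u e0) e0 (theta e0) ->
  exists g, [/\ facewise g, stray (regauge g u) e0 = false &
    subpred (stray (regauge g u)) (stray u)].
Proof.
move=> [cu _] su /joined_chain [z0 [phi [zt zN ps]]].
pose z d := z0 d (+) ((d == e0) (+) (d == theta e0)).
have [||f fE] := sep (z := z) (phi := phi).
- move=> d; rewrite /z zt (can_eq (@thetaK D)).
  by rewrite theta_eq [(d == theta e0) (+) _]addbC.
- by move=> d; rewrite ps /z -addbA.
have z0e0 : z0 e0 = false.
  apply/negP => /zN; rewrite /used_but eqxx thetaK eqxx !andbF.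
  by [].
have ze0 : z e0.
  by rewrite /z z0e0 eqxx; case: eqP => // /esym /theta_free.
(* [e0] and its inverse lie on different sides of the cycle, so its label is
   multiplied by the constant on the right or on the left only. *)
pose h := if f e0 then u e0 else (u e0)^-1.
pose g e := if f e then h else 1.
have same e : z e = false -> (regauge g u e == 1) = (u e == 1).
  move=> ze; rewrite /regauge /g (fE e).2 ze addbF.
  case: (f e); last by rewrite invg1 mul1g mulg1.
  by rewrite -(conjg_eq1 (u e) h^-1) conjgE invgK mulgA.
exists g; split.
- by move=> d; rewrite /g (fE d).1 (fE d).2.
- rewrite /stray (_ : regauge g u e0 = 1) ?eqxx //.
  rewrite /regauge /g (fE e0).2 ze0 /h; case: (f e0) => /=.
    by rewrite mul1g mulgV.
  by rewrite invg1 mulg1 mulVg.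
move=> e /andP[ue ep]; rewrite /stray ep andbT.
have [ze|ze] := boolP (z e); last by rewrite -same // (negPf ze).
have [ee0|ne] := eqVneq e e0; first by rewrite ee0; case/andP: su.
have [ete|nte] := eqVneq e (theta e0).
  by rewrite ete cocycle_theta_eq1 //; case/andP: su.
have : z0 e by move: ze; rewrite /z (negPf ne) (negPf nte) !addbF.
move=> /zN; rewrite /used_but used_theta // /used (negPf ep) orbF.
by case/orP => /and3P[].
Qed.

(** A stray [e] is a bridge, and the component of its source, after removal of
    the bridge, avoids the path.  As the holonomy at the source is trivial,
    another stray dart starts there, and the component beyond that second
    bridge is strictly smaller: infinite descent on the number of stray darts
    in the component. *)
Lemma stray_descent u (S : seq D) : admissible u ->
  (forall e, stray u e -> e \in S) ->
  (forall e, stray u e -> ~ joined (used_but u e) e (theta e)) ->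
  forall n e, stray u e ->
    (forall d, edge_of p d -> ~ joined (used_but u e) e d) ->
    (count (fun d => stray u d && `[< joined (used_but u e) e d >]) S <= n)%N ->
    False.
Proof.
move=> [cu fu] inS bridge; elim=> [|n IHn] e0 se0 noP cnt.
  move: cnt; rewrite leqNgt -has_count => /hasP[]; exists e0; first exact: inS.
  by rewrite se0; apply/asboolP; exact: joined_refl.
have fe0 : flat u e0.
  apply: fu => d de; apply/negP => dp; apply: (noP d dp).
  exact: joined_vertex (esym de).
have [m deg] := degree_exists e0 fin.
have [e1 [ve1 ne1 ue1]] : exists e1, [/\ vertex e1 = vertex e0, e1 != e0 &
    u e1 != 1].
  apply: contrapT => no.
  have : u e0 = 1.
    rewrite -(fe0 m deg); apply/esym/holonomy_single => // d vd ud.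
    by apply/eqP/negPn/negP => nd; apply: no; exists d.
  by case/andP: se0 => /eqP.
have j01 : joined (used_but u e0) e0 e1 by exact: joined_vertex (esym ve1).
have nt1 : theta e1 != e0.
  apply: contra_notN (bridge _ se0) => /eqP E.
  by have -> : theta e0 = e1 by rewrite -E thetaK.
have np1 : ~~ edge_of p e1 by apply/negP => h; exact: noP h j01.
have se1 : stray u e1 by rewrite /stray ue1.
have ste1 : stray u (theta e1) by rewrite stray_theta.
have uN1 : used_but u e0 e1 by rewrite /used_but /used ue1 ne1.
(* A dart in both components does not belong to the bridge [e0], so the step
   along its edge stays in the component of [e0]. *)
have sub d : joined (used_but u (theta e1)) (theta e1) d ->
    joined (used_but u e0) e0 d.
  pose A x := joined (used_but u e0) e0 x /\
    joined (used_but u (theta e1)) (theta e1) x.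
  have A_e0 x : A x -> x != e0 /\ x != theta e0.
    move=> [j0 j1]; split; apply/eqP => E; rewrite E in j0 j1.
      apply: (bridge _ ste1); rewrite thetaK; apply: joined_trans j1 _.
      exact: joined_vertex (esym ve1).
    exact: bridge j0.
  have step x : used_but u (theta e1) x -> A x \/ A (theta x) ->
      used_but u e0 x.
    move=> /and3P[ux _ _] Ax; rewrite /used_but ux /=.
    case: Ax => /A_e0 [n1 n2]; first by rewrite n1 theta_eq.
    by rewrite n1 andbT; move: n2; rewrite (can_eq (@thetaK D)).
  move=> jd; suff: A d by case.
  apply: (joined_elim jd) => [x|x Nx|].
  - split=> -[j0 j1]; split.
    + exact: joined_trans j0 (joined_sigma _ _).
    + exact: joined_trans j1 (joined_sigma _ _).
    + exact: joined_trans j0 (joined_sym (joined_sigma _ _)).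
    + exact: joined_trans j1 (joined_sym (joined_sigma _ _)).
  - split=> Ax.
      have N0 := step x Nx (or_introl Ax); case: Ax => j0 j1; split.
        exact: joined_trans j0 (joined_theta N0).
      exact: joined_trans j1 (joined_theta Nx).
    have N0 := step x Nx (or_intror Ax); case: Ax => j0 j1; split.
      exact: joined_trans j0 (joined_sym (joined_theta N0)).
    exact: joined_trans j1 (joined_sym (joined_theta Nx)).
  - by split; [exact: joined_trans j01 (joined_theta uN1)|exact: joined_refl].
apply: (IHn (theta e1)) => //.
  by move=> d dp /sub; exact: noP.
rewrite -ltnS; apply: leq_trans cnt.
apply: (@sub_count_lt _ _ _ _ e1) => //.
- by move=> d /andP[-> /asboolP /sub h]; apply/asboolP.
- exact: inS.
- by rewrite se1; apply/asboolP.
- rewrite se1; apply/asboolP => h; apply: (bridge _ ste1).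
  by rewrite thetaK.
Qed.

(** The path is connected and contains no stray edge, so it lies on one side of
    a stray bridge; [stray_descent] applies to the other side. *)
Lemma bridges_impossible u (S : seq D) : admissible u ->
  (forall e, stray u e -> e \in S) ->
  (forall e, stray u e -> ~ joined (used_but u e) e (theta e)) ->
  forall e, ~ stray u e.
Proof.
move=> au inS bridge e se.
have cu := au.1.
have ste : stray u (theta e) by rewrite stray_theta.
have [[d dp jd]|no] := pselect (exists2 d, edge_of p d &
    joined (used_but u e) e d); last first.
  apply: (stray_descent au inS bridge se) (leqnn _) => d dp jd.
  by apply: no; exists d.
apply: (stray_descent au inS bridge ste) (leqnn _) => d' d'p jd'.
apply: (bridge e se); apply: joined_trans jd _.
apply: joined_trans (walk_joined wp _ dp d'p) _.
  move=> x xp; rewrite /used_but /used xp orbT /=.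
  case/andP: se => _ ne; apply/andP; split.
    by apply: contraNneq ne => <-.
  by apply: contraNneq ne => <-; rewrite edge_of_theta.
apply: joined_sym; case: jd' => jd'; constructor=> A As At.
apply: jd' => // x /and3P[ux x1 x2]; apply: At; rewrite /used_but ux /=.
by move: x1 x2; rewrite (can_eq (@thetaK D)) theta_eq => -> ->.
Qed.

Lemma regauge_admissible g u : facewise g -> admissible u ->
  admissible (regauge g u).
Proof.
move=> fg [cu fu]; split; first exact: regauge_cocycle.
by move=> e h; apply: regauge_flat => //; exact: fu.
Qed.

Lemma concentrate_on_path u (S : seq D) : admissible u ->
  (forall e, stray u e -> e \in S) ->
  exists2 g, facewise g & forall e, regauge g u e != 1 -> edge_of p e.
Proof.
move=> au inS; have [n] := ubnP (count (stray u) S).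
elim: n u au inS => // n IHn u au inS cnt.
have [[e se je]|no] := pselect (exists2 e, stray u e &
    joined (used_but u e) e (theta e)); last first.
  exists (fun=> 1) => // e; rewrite /regauge mul1g invg1 mulg1 => ue.
  apply: contrapT => /negP ep.
  apply: (@bridges_impossible u S au inS _ e); last by rewrite /stray ue.
  by move=> d sd jd; apply: no; exists d.
have [g [fg gse gsub]] := kill_edge au se je.
have [|||g' fg' hg'] := IHn (regauge g u).
- exact: regauge_admissible.
- by move=> d /gsub /inS.
- rewrite -ltnS; apply: leq_trans cnt; rewrite ltnS.
  by apply: (@sub_count_lt _ _ _ _ e) => //; [exact: inS | rewrite gse].
exists (fun d => g' d * g d); first by move=> d; rewrite fg fg'.
by move=> d; rewrite -regauge_comp; exact: hg'.
Qed.
End Concentrate.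

(** * Labels supported by a simple path *)

Section WalkVertices.
Variables (D : plane_graph) (a c : set D) (p : seq D).
Hypotheses (wp : walk a p c) (up : uniq (visited a p)).
Variable x0 : D.
Implicit Types (d e : D).
Local Notation x i := (nth x0 p i).
Local Notation V i := (nth set0 (visited a p) i).

Lemma size_visited : size (visited a p) = (size p).+1.
Proof. by rewrite /= size_map. Qed.

Lemma visited_inj i j :
  (i <= size p)%N -> (j <= size p)%N -> V i = V j -> i = j.
Proof.
move=> ip jp /eqP; rewrite nth_uniq ?size_visited ?ltnS //.
by move/eqP.
Qed.

Lemma vertex_nth i : (i < size p)%N -> vertex (x i) = V i.
Proof. by move=> ip; have [] := walk_nth x0 wp ip. Qed.

Lemma vertex_theta_nth i : (i < size p)%N -> vertex (theta (x i)) = V i.+1.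
Proof. by move=> ip; have [] := walk_nth x0 wp ip. Qed.

(** On a simple path a vertex is left only by the next edge and by the inverse
    of the previous one. *)
Lemma incident d j : (j <= size p)%N -> edge_of p d -> vertex d = V j ->
  ((j < size p)%N /\ d = x j) \/ ((0 < j)%N /\ d = theta (x j.-1)).
Proof.
move=> jp /orP[] /(nthP x0) [i ip E] vd.
  left; have ij : i = j.
    by apply: visited_inj => //; [exact: ltnW | rewrite -vertex_nth // E].
  by rewrite -ij.
right; have ij : i.+1 = j.
  by apply: visited_inj => //; rewrite -vertex_theta_nth // E thetaK.
by rewrite -ij /= E thetaK.
Qed.

Variables (H : groupType) (u : D -> H).
Hypotheses (cu : cocycle u) (supp : forall e, u e != 1 -> edge_of p e).

Lemma holonomy_start n : (0 < size p)%N -> is_degree n (x 0) ->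
  holonomy u n (x 0) = u (x 0).
Proof.
move=> p0 deg; apply: holonomy_single => // d.
rewrite vertex_nth // => vd /supp dp.
by have [[]|[]] := incident (leq0n _) dp vd.
Qed.

Lemma holonomy_end n : (0 < size p)%N ->
  is_degree n (theta (x (size p).-1)) ->
  holonomy u n (theta (x (size p).-1)) = (u (x (size p).-1))^-1.
Proof.
move=> p0 deg; rewrite -cu; apply: holonomy_single => // d.
have pp : ((size p).-1 < size p)%N by rewrite prednK.
rewrite vertex_theta_nth // prednK // => vd /supp dp.
have [[]|[]//] := incident (leqnn _) dp vd.
by rewrite ltnn.
Qed.

Lemma holonomy_middle n j :
  (0 < j < size p)%N -> is_degree n (theta (x j.-1)) ->
  holonomy u n (theta (x j.-1)) = u (x j) * (u (x j.-1))^-1.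
Proof.
case: j => //= j jp deg.
have jp' : (j < size p)%N := ltnW jp.
rewrite -cu; apply: holonomy_pair => //.
- by rewrite vertex_theta_nth // vertex_nth.
- move=> E; have xj : x j \in p by exact: mem_nth.
  have tx : theta (x j) \in p by rewrite -E mem_nth.
  exact: simple_no_inverse wp up xj tx.
move=> d; rewrite vertex_theta_nth // => vd /supp dp.
by have [[_ ->]|[_ ->]] := incident (ltnW jp) dp vd; [right|left].
Qed.

End WalkVertices.

Section Labels.
Variables (D : plane_graph) (a b c : set D) (P : simple_path a b c).
Implicit Types (d e : D).

(** The elements that act on the double chambers of every plane graph by the
    permutations s_(P,e), see [act_label]. *)
Definition label e : Z2freeZ :=
  if e \in P2 P then gen_b
  else if e \in P1 P then gen_a^-1
  else if e \in P2' P then gen_b^-1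
  else if e \in P1' P then gen_a
  else 1.

Definition path_of := part1 P ++ part2 P.
Local Notation p := path_of.
Local Notation k := (size (part1 P)).

Lemma path_walk : walk a p c. Proof. exact: walk_cat (walk1 P) (walk2 P). Qed.
Lemma path_uniq : uniq (visited a p). Proof. exact: path_simple. Qed.

Lemma path_theta e : e \in p -> theta e \in p -> False.
Proof. exact: simple_no_inverse path_walk path_uniq. Qed.

Lemma path_uniq_seq : uniq p.
Proof. by have /= /andP[_ /map_uniq] := path_uniq. Qed.

Lemma label_part1 e : e \in part1 P -> label e = gen_a^-1.
Proof.
move=> e1; have ep : e \in p by rewrite mem_cat e1.
rewrite /label /P2 mem_map_theta /P1 e1.
case: ifP => // t2; case: (@path_theta e ep).
by rewrite mem_cat t2 orbT.
Qed.

Lemma label_part2 e : e \in part2 P -> label e = gen_b^-1.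
Proof.
move=> e2; have ep : e \in p by rewrite mem_cat e2 orbT.
rewrite /label /P2 mem_map_theta /P1 /P2' e2.
case: ifP => [t2|_].
  by case: (@path_theta e ep); rewrite mem_cat t2 orbT.
case: ifP => // e1; have := path_uniq_seq.
by rewrite cat_uniq => /and3P[_ /hasPn/(_ e e2)]; rewrite /= e1.
Qed.

Lemma label_theta_part1 e : e \in part1 P -> label (theta e) = gen_a.
Proof.
move=> e1; have ep : e \in p by rewrite mem_cat e1.
have tp : theta e \notin p by apply/negP; exact: path_theta ep.
move: (tp); rewrite mem_cat negb_or => /andP[/negPf t1 /negPf t2].
rewrite /label /P2 /P1' !mem_map_theta /P1 /P2' thetaK t1 t2 e1.
case: ifP => // e2; have := path_uniq_seq.
by rewrite cat_uniq => /and3P[_ /hasPn/(_ e e2)]; rewrite /= e1.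
Qed.

Lemma label_theta_part2 e : e \in part2 P -> label (theta e) = gen_b.
Proof. by move=> e2; rewrite /label /P2 mem_map_theta thetaK e2. Qed.

Lemma label_off e : ~~ edge_of p e -> label e = 1.
Proof.
rewrite /edge_of !mem_cat !negb_or => /andP[/andP[/negPf n1 /negPf n2]].
move=> /andP[/negPf n3 /negPf n4].
by rewrite /label /P2 /P1' !mem_map_theta /P1 /P2' n1 n2 n3 n4.
Qed.

Lemma label_supp e : label e != 1 -> edge_of p e.
Proof. by move=> h; apply: contraNT h => /label_off ->. Qed.

Lemma label_cocycle : cocycle label.
Proof.
have H e : e \in p -> label (theta e) = (label e)^-1.
  rewrite mem_cat => /orP[e1|e2].
    by rewrite label_theta_part1 // label_part1 // invgK.
  by rewrite label_theta_part2 // label_part2 // invgK.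
move=> e; have [/orP[/H //|/H]|ne] := boolP (edge_of p e).
  by rewrite thetaK => ->; rewrite invgK.
by rewrite !label_off ?invg1 // edge_of_theta.
Qed.

Variable x0 : D.
Local Notation x i := (nth x0 p i).
Local Notation V i := (nth set0 (visited a p) i).

Lemma label_nth i : (i < size p)%N ->
  label (x i) = if (i < k)%N then gen_a^-1 else gen_b^-1.
Proof.
move=> ip; rewrite nth_cat; case: ifP => ik.
  by rewrite label_part1 // mem_nth.
rewrite label_part2 // mem_nth //.
have : (i < size (part1 P) + size (part2 P))%N by rewrite -size_cat.
change (i < k + size (part2 P) -> i - k < size (part2 P))%N.
by move: ik; clear; lia.
Qed.

Lemma walk_last (a' : set D) q b' :
  walk a' q b' -> nth set0 (visited a' q) (size q) = b'.
Proof. by elim: q a' => //= e q IHq a' [_ /IHq]. Qed.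

Lemma visited_end : V (size p) = c. Proof. exact: walk_last path_walk. Qed.
Lemma visited_middle : V k = b.
Proof.
rewrite -{2}(walk_last (walk1 P)) /visited /path_of map_cat -cat_cons nth_cat.
by rewrite /= size_map ltnSn.
Qed.

Lemma k_le : (k <= size p)%N. Proof. by rewrite size_cat leq_addr. Qed.

(** At an inner vertex of a half of the path the labels of the two edges of the
    path cancel. *)
Lemma label_flat e : finite_degrees D ->
  vertex e <> a -> vertex e <> b -> vertex e <> c -> flat label e.
Proof.
move=> fin ea eb ec n deg.
have [[j jp Ej]|no] := pselect (exists2 j, (j <= size p)%N & vertex e = V j);
    last first.
  apply: holonomy1 => i ni; apply: label_off; apply/negP => ip; apply: no.
  rewrite -(vertex_iter i); move: (iter i _ e) ip => d.
  case/orP => /(nthP x0) [l lp E].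
    exists l; first exact: ltnW.
    by rewrite -E (vertex_nth path_walk).
  by exists l.+1 => //; rewrite -(vertex_theta_nth path_walk x0 lp) E thetaK.
have j0 : (0 < j)%N.
  by rewrite lt0n; apply/eqP => j0; apply: ea; rewrite Ej j0.
have jp' : (j < size p)%N.
  rewrite ltn_neqAle jp andbT; apply/eqP => E; apply: ec.
  by rewrite Ej E visited_end.
have jk : j <> k by move=> E; apply: eb; rewrite Ej E visited_middle.
have vt : vertex (theta (x j.-1)) = vertex e.
  by rewrite (vertex_theta_nth path_walk) ?prednK // (leq_trans _ jp').
have [g E] := holonomy_conj label (g := fun=> 1) (fun=> erefl) deg vt.
have -> : holonomy label n e = holonomy (regauge (fun=> 1) label) n e.
  by rewrite holonomy_regauge // mul1g invg1 mulg1.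
rewrite E (holonomy_middle path_walk path_uniq label_cocycle label_supp).
- rewrite !label_nth //; last by lia.
  have -> : (j.-1 < k)%N = (j < k)%N by lia.
  by rewrite mulgV conj1g.
- by rewrite j0.
- exact: is_degree_vertex vt.
Qed.

Lemma label_admissible p' : finite_degrees D ->
  (forall v : set D, v = a \/ v = b \/ v = c ->
     forall e, vertex e = v -> exists2 d, edge_of p' d & vertex d = v) ->
  admissible p' label.
Proof.
move=> fin H; split; first exact: label_cocycle.
move=> e ne; have K v : v = a \/ v = b \/ v = c -> vertex e <> v.
  move=> vabc ev; have [d dp dv] := H v vabc e ev.
  by have := ne d; rewrite dv ev dp => /(_ erefl).
by apply: label_flat => //; apply: K; tauto.
Qed.

End Labels.

(** * Comparing two paths *)

Lemma gen_aV : gen_a^-1 = gen_a.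
Proof. by apply: mulg1_eq; apply: val_inj. Qed.

Section Compare.
Variables (D : plane_graph) (a b c : set D) (P Q : simple_path a b c).
Hypothesis fin : finite_degrees D.
Implicit Types (d e : D).
Local Notation p := (path_of P).
Local Notation q := (path_of Q).
Local Notation k := (size (part1 P)).
Local Notation l := (size (part1 Q)).

(** Both sides say that [a] and [b] are different. *)
Lemma part1_nonempty : (0 < k)%N = (0 < l)%N.
Proof.
suff H (P' Q' : simple_path a b c) :
    (0 < size (part1 P'))%N -> (0 < size (part1 Q'))%N.
  by apply/idP/idP; exact: H.
rewrite !lt0n; apply: contraNN => /eqP l0; apply/eqP.
apply: (visited_inj (path_uniq P')) => //; first exact: k_le.
apply: etrans (visited_middle P') (etrans (esym (visited_middle Q')) _).
by rewrite l0.
Qed.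

Lemma part2_nonempty : (k < size p)%N = (l < size q)%N.
Proof.
suff H (P' Q' : simple_path a b c) :
    (size (part1 P') < size (path_of P'))%N ->
    (size (part1 Q') < size (path_of Q'))%N.
  by apply/idP/idP; exact: H.
rewrite ltn_neqAle => /andP[ne _]; rewrite ltn_neqAle k_le andbT.
apply: contraNN ne => /eqP E; apply/eqP.
apply: (visited_inj (path_uniq P')) => //; first exact: k_le.
apply: etrans (visited_middle P') (etrans (esym (visited_middle Q')) _).
by rewrite E !visited_end.
Qed.

Lemma visited_dart (x0 : D) j : (0 < size p)%N -> (j <= size p)%N ->
  exists2 d, edge_of p d & vertex d = nth set0 (visited a p) j.
Proof.
move=> p0; rewrite leq_eqVlt => /orP[/eqP ->|jp].
  exists (theta (nth x0 p (size p).-1)).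
    by rewrite edge_of_theta /edge_of mem_nth // prednK.
  by rewrite (vertex_theta_nth (path_walk P)) prednK.
exists (nth x0 p j); first by rewrite /edge_of mem_nth.
by rewrite (vertex_nth (path_walk P)).
Qed.

Variables (x0 : D) (g : D -> Z2freeZ).
Hypotheses (p0 : (0 < size p)%N) (fg : facewise g)
  (supp : forall e, regauge g (label Q) e != 1 -> edge_of p e).
Local Notation v := (regauge g (label Q)).
Local Notation x i := (nth x0 p i).
Local Notation y i := (nth x0 q i).
Local Notation V i := (nth set0 (visited a p) i).

Let cv : cocycle v. Proof. exact/regauge_cocycle/label_cocycle. Qed.

Let compare n e d : is_degree n e -> vertex d = vertex e ->
  exists z, holonomy v n e = holonomy (label Q) n d ^ z.
Proof. exact: holonomy_conj. Qed.

Lemma value_start : (0 < k)%N -> exists z, v (x 0) = gen_a^-1 ^ z.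
Proof.
move=> k0; have l0 : (0 < l)%N by rewrite -part1_nonempty.
have q0 : (0 < size q)%N by apply: leq_trans (k_le Q).
have [n deg] := degree_exists (x 0) fin.
have yx : vertex (y 0) = vertex (x 0).
  by rewrite (vertex_nth (path_walk P)) // (vertex_nth (path_walk Q)).
have [z E] := compare deg yx; exists z.
rewrite -(holonomy_start (path_walk P) (path_uniq P) supp p0 deg) E.
have deg' := is_degree_vertex deg yx.
rewrite (holonomy_start (path_walk Q) (path_uniq Q) (@label_supp _ _ _ _ Q)
  q0 deg').
by rewrite label_nth // l0.
Qed.

Lemma value_end : (k < size p)%N ->
  exists z, (v (x (size p).-1))^-1 = gen_b ^ z.
Proof.
rewrite part2_nonempty => lq; have q0 : (0 < size q)%N by lia.
have [n deg] := degree_exists (theta (x (size p).-1)) fin.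
have yx : vertex (theta (y (size q).-1)) = vertex (theta (x (size p).-1)).
  rewrite (vertex_theta_nth (path_walk P)) ?(vertex_theta_nth (path_walk Q));
    by rewrite ?prednK // !visited_end.
have [z E] := compare deg yx; exists z.
rewrite -(holonomy_end (path_walk P) (path_uniq P) cv supp p0 deg) E.
have deg' := is_degree_vertex deg yx.
rewrite (holonomy_end (path_walk Q) (path_uniq Q) (@label_cocycle _ _ _ _ Q)
  (@label_supp _ _ _ _ Q) q0 deg').
rewrite label_nth ?prednK //.
by rewrite leqNgt lq invgK.
Qed.

Lemma value_middle : (0 < k < size p)%N ->
  exists z, v (x k) * (v (x k.-1))^-1 = (gen_b^-1 * gen_a) ^ z.
Proof.
move=> kp; have /andP[k0 kp'] := kp.
have lq : (0 < l < size q)%N by rewrite -part1_nonempty -part2_nonempty.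
have /andP[l0 lq'] := lq.
have [n deg] := degree_exists (theta (x k.-1)) fin.
have yx : vertex (theta (y l.-1)) = vertex (theta (x k.-1)).
  rewrite (vertex_theta_nth (path_walk P)); last by lia.
  rewrite (vertex_theta_nth (path_walk Q)); last by lia.
  by rewrite !prednK // !visited_middle.
have [z E] := compare deg yx; exists z.
rewrite -(holonomy_middle (path_walk P) (path_uniq P) cv supp kp deg) E.
have deg' := is_degree_vertex deg yx.
rewrite (holonomy_middle (path_walk Q) (path_uniq Q) (@label_cocycle _ _ _ _ Q)
  (@label_supp _ _ _ _ Q) lq deg').
rewrite !label_nth //; last by lia.
by rewrite ltnn prednK // leqnn invgK.
Qed.

(** The vertex between the two edges is not special, so the holonomy of the
    [Q]-labelling is trivial there, and it stays trivial in every gauge. *)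
Lemma value_step i : (i.+1 < size p)%N -> i.+1 <> k -> v (x i.+1) = v (x i).
Proof.
move=> ip ik; have [n deg] := degree_exists (theta (x i)) fin.
have Vi : vertex (theta (x i)) = V i.+1.
  by rewrite (vertex_theta_nth (path_walk P)) // ltnW.
have inj := visited_inj (path_uniq P).
have fl : flat v (theta (x i)).
  apply: regauge_flat => //; apply: (label_flat Q x0 fin); rewrite Vi.
  - by move=> E; have := inj i.+1 0%N (ltnW ip) (leq0n _) E.
  - move=> E; apply: ik; apply: inj (ltnW ip) (k_le P) _.
    by rewrite E visited_middle.
  - move=> E; have := inj i.+1 _ (ltnW ip) (leqnn _).
    by rewrite E visited_end => /(_ erefl); lia.
have := fl n deg.
rewrite (holonomy_middle (j := i.+1) (path_walk P) (path_uniq P) cv supp) //.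
exact: divg1_eq.
Qed.

Lemma value_part1 i : (i < k)%N -> v (x i) = v (x 0).
Proof.
elim: i => // i IHi ik; rewrite value_step ?IHi //.
- exact: ltnW.
- exact: leq_trans ik (k_le P).
- lia.
Qed.

Lemma value_part2 i : (k <= i < size p)%N -> v (x i) = v (x (size p).-1).
Proof.
move=> /andP[ki ip]; have [j Ej] : exists j, j = ((size p).-1 - i)%N by eexists.
elim: j i ki ip Ej => [|j IHj] i ki ip Ej.
  by have -> : i = (size p).-1 by lia.
rewrite -value_step; [apply: IHj; lia | lia | lia].
Qed.

(** If both halves of the path have edges, [conj_pair] turns the comparisons
    at v1, v2 and v0 into a common conjugator.  Otherwise there is at most one
    value to conjugate. *)
Lemma values_conjugate : exists h,
  ((0 < k)%N -> v (x 0) = gen_a^-1 ^ h) /\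
  ((k < size p)%N -> v (x (size p).-1) = gen_b^-1 ^ h).
Proof.
have [k0|k0] := posnP k.
  have [kp|kp] := ltnP k (size p); last by exists 1.
  have [z E] := value_end kp; exists z; split=> // _.
  by rewrite conjVg -E invgK.
have [z1 E1] := value_start k0.
have [kp|kp] := ltnP k (size p); last by exists z1.
have [z2 E2] := value_end kp.
have [z3 E3] := value_middle (introT andP (conj k0 kp)).
rewrite (value_part2 (i := k)) ?leqnn // (value_part1 (i := k.-1)) in E3;
  last by lia.
have E4 : v (x 0) * (v (x (size p).-1))^-1 = (gen_a * gen_b) ^ z3.
  rewrite -[LHS]invgK invgM invgK E3 -conjVg invgM invgK gen_aV.
  by [].
rewrite gen_aV in E1.
have [h [h1 h2]] := conj_pair E1 E2 E4; exists h; split=> _.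
  by rewrite gen_aV.
by rewrite conjVg -h2 invgK.
Qed.

Lemma label_regauge : exists2 g', facewise g' &
  forall e, label P e = regauge g' (label Q) e.
Proof.
have [h [h1 h2]] := values_conjugate.
exists (fun e => h * g e); first by move=> e; rewrite fg.
move=> e; rewrite -(@regauge_comp _ _ g (fun=> h)).
have H d : d \in p -> label P d = regauge (fun=> h) v d.
  move=> /(nthP x0) [i ip <-]; rewrite label_nth // /regauge -/(v _).
  have [ik|ki] := ltnP i k.
    rewrite value_part1 // h1 ?(leq_ltn_trans _ ik) //.
    by rewrite conjgE !mulgA mulgV mul1g mulgK.
  rewrite value_part2 ?ki // h2 ?(leq_ltn_trans ki) //.
  by rewrite conjgE !mulgA mulgV mul1g mulgK.
have [/orP[/H //|/H E]|ne] := boolP (edge_of p e).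
  rewrite -[e]thetaK (label_cocycle P) E.
  by rewrite (regauge_cocycle (fun=> h) cv (theta e)).
have v1 : v e = 1 by apply/eqP/negPn; apply: contraNN ne; exact: supp.
by rewrite label_off // /regauge -/(v e) v1 mulg1 mulgV.
Qed.

End Compare.

Lemma labels_gauge_equivalent (D : plane_graph) (a b c : set D)
    (P Q : simple_path a b c) :
  finite_degrees D -> even_sets_separate D ->
  exists2 g, facewise g & forall e, label P e = regauge g (label Q) e.
Proof.
move=> fin sep.
have [[x0 p0]|p0] := pselect (exists x0 : D, (0 < size (path_of P))%N);
    last first.
  have p0' : size (path_of P) = 0%N.
    by case E: (path_of P) => [|x s] //; case: p0; exists x; rewrite E.
  have q0 : size (path_of Q) = 0%N.
    apply: (visited_inj (path_uniq Q)) => //.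
    apply: etrans (visited_end Q) (etrans (esym (visited_end P)) _).
    by rewrite p0'.
  exists (fun=> 1) => // e; rewrite /regauge mul1g invg1 mulg1.
  by rewrite !label_off // /edge_of ?(size0nil p0') ?(size0nil q0).
have adm : admissible (path_of P) (label Q).
  apply: (label_admissible Q x0 fin) => v vabc e ev.
  have [j jp Ej] : exists2 j, (j <= size (path_of P))%N &
      nth set0 (visited a (path_of P)) j = v.
    case: vabc => [->|[->|->]]; first by exists 0%N.
      by exists (size (part1 P)); [exact: k_le|exact: visited_middle].
    by exists (size (path_of P)); [|exact: visited_end].
  by have [d dp dv] := visited_dart x0 p0 jp; exists d => //; rewrite dv.
have [|g fg supp] := concentrate_on_path fin sep (path_walk P)
    (S := path_of Q ++ map (@theta D) (path_of Q)) adm.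
  move=> e /andP[/label_supp + _]; rewrite mem_cat mem_map_theta.
  by [].
by case: (label_regauge fin x0 p0 fg supp) => g' fg' E; exists g'.
Qed.

(** * From labels to applications *)

Section Evaluation.
Variable G : plane_graph.
Definition act_letter (x : letter) : double_chamber G -> double_chamber G :=
  match x with None => @s1 G | Some true => @s2 G | Some false => @s2V G end.
Definition act_word (w : seq letter) (c : double_chamber G) :=
  foldr act_letter c w.
Definition act (h : Z2freeZ) := act_word (word h).

Lemma act_letterK x : cancel (act_letter x) (act_letter (flip x)).
Proof. by case: x => [[]|]; [exact: s2K | exact: s2VK | exact: s1K]. Qed.

Lemma act_normalize w c : act_word (normalize w) c = act_word w c.
Proof.
elim: w => //= x w IHw; rewrite -IHw /normalize /= -/(normalize w).
case: (normalize w) => //= y w'; case: eqP => [->|//] /=.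
by rewrite -{1}[x]flipK act_letterK.
Qed.

Lemma actM h h' c : act (h * h') c = act h (act h' c).
Proof. by rewrite /act /= act_normalize /act_word foldr_cat. Qed.

Lemma act1 c : act 1 c = c. Proof. by []. Qed.

Lemma act_label (D : plane_graph) (a b c : set D) (P : simple_path a b c) e x :
  act (label P e) x = s_ P e x.
Proof.
rewrite /label /s_ gen_aV -(of_word_letter_b false).
by do 4?case: ifP => _.
Qed.

Lemma application_isomorphic (D : plane_graph) (a b c : set D)
    (P Q : simple_path a b c) g :
  facewise g -> (forall e, label P e = regauge g (label Q) e) ->
  isomorphic (application P G) (application Q G).
Proof.
move=> fg E.
pose F (ec : application P G) : application Q G :=
  (ec.1, act (g ec.1)^-1 ec.2).
pose F' (ec : application Q G) : application P G :=
  (ec.1, act (g ec.1) ec.2).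
have step e x : act (g (theta e))^-1 (s_ P e x) = s_ Q e (act (g e)^-1 x).
  by rewrite -!act_label E -!actM /regauge !mulgA mulVg mul1g.
exists F; split.
- exists F' => -[e x]; rewrite /F /F' /= -actM ?mulgV ?mulVg act1 //.
- by case=> e x; rewrite /F /= /sigmaP /= fg step.
- by case=> e x; rewrite /F /= /thetaP /= step.
Qed.
End Evaluation.

Import Order.TTheory GRing.Theory Num.Theory.
Import numFieldNormedType.Exports.
Local Open Scope ring_scope.

(** * Double coverings of the plane *)

(** Compactness of [a, b] for a property of intervals that holds for short
    intervals and is inherited by concatenation: the supremum of the points [x]
    with [P a x] is such a point itself, and it cannot be smaller than [b]. *)
Lemma interval_induction (R : realType) (a b : R) (P : R -> R -> Prop) :
  a <= b ->
  (forall x y z, a <= x -> x <= y -> y <= z -> z <= b ->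
     P x y -> P y z -> P x z) ->
  (forall t, a <= t <= b -> exists2 e, 0 < e &
     forall x y, a <= x <= t -> t <= y <= b -> t - e < x -> y < t + e ->
       P x y) ->
  P a b.
Proof.
move=> leab Padd Ploc.
pose S := [set x : R | a <= x <= b /\ P a x].
have Sa : S a.
  have [|e e0 he] := Ploc a; first by rewrite lexx.
  by split; rewrite ?lexx ?leab //; apply: he; rewrite ?lexx ?leab //; lra.
have Sub : has_sup S.
  by split; [exists a | exists b => x [/andP[]]].
pose t := sup S.
have at_ : a <= t by apply: ub_le_sup => //; case: Sub.
have tb : t <= b by apply: ge_sup; [exists a | move=> x [/andP[]]].
have [|e e0 he] := Ploc t; first by rewrite at_.
have [x [/andP[ax xb] Pax] xt] := sup_adherent e0 Sub.
have lext : x <= t by apply: ub_le_sup; [case: Sub | split=> //; rewrite ax].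
have Px y : t <= y <= b -> y < t + e -> P a y.
  move=> /andP[ty yb] yt; apply: (Padd a x y) => //.
    exact: le_trans ty.
  by apply: he; rewrite ?ax ?lext ?ty ?yb.
have [tb'|] := ltP t b; last by move=> bt; apply: Px; lra.
pose y := Num.min b (t + e / 2).
have ty : t < y by rewrite lt_min tb'; lra.
have yb : y <= b by rewrite ge_min lexx.
have yte : y < t + e by rewrite gt_min; apply/orP; right; lra.
suff : y <= t by lra.
apply: ub_le_sup; first by case: Sub.
split; first by rewrite yb andbT (le_trans at_) // ltW.
by apply: Px => //; rewrite yb (ltW ty).
Qed.

Lemma locally_constant01 (R : realType) (b : R -> bool) :
  (forall t, 0 <= t <= 1 -> exists2 e, 0 < e &
     forall x, 0 <= x <= 1 -> `|x - t| < e -> b x = b t) ->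
  b 0 = b 1.
Proof.
move=> loc; apply: (@interval_induction _ _ _ (fun x y => b x = b y)).
- exact: ler01.
- by move=> x y z _ _ _ _ ->.
move=> t t01; have [e e0 he] := loc t t01; exists e => // x y x01 y01 xt yt.
by rewrite (he x) ?(he y) // ?ltr_norml; lra.
Qed.

Section Drawing.
Variables (R : realType) (T : tiling R).
Implicit Types (x y : chamber T) (z : plane R) (p : 'rV[R]_3).

Lemma closed_coord_ge (i : 'I_3) : closed [set p : 'rV[R]_3 | 0 <= p 0 i].
Proof.
apply: (@closed_comp _ _ (fun p : 'rV[R]_3 => p 0 i) [set u | 0 <= u]).
  by move=> p _; exact: coord_continuous.
exact: closed_ge.
Qed.

Lemma closed_coord_eq (i : 'I_3) : closed [set p : 'rV[R]_3 | p 0 i = 0].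
Proof.
apply: (@closed_comp _ _ (fun p : 'rV[R]_3 => p 0 i) [set u | u = 0]).
  by move=> p _; exact: coord_continuous.
exact: closed_eq.
Qed.

Lemma compact_face (I : {set 'I_3}) :
  compact [set p : 'rV[R]_3 | triangle p /\ forall i, i \in I -> p 0 i = 0].
Proof.
apply: (@subclosed_compact _ _
  [set p : 'rV[R]_3 | forall i, `[0, 1]%classic (p ord0 i)]); last 1 first.
- move=> p [[p0 p1] _] i; rewrite /= in_itv /= p0 /= -p1 (bigD1 i) //=.
  by rewrite lerDl sumr_ge0.
- have -> : [set p : 'rV[R]_3 | triangle p /\
      forall i, i \in I -> p 0 i = 0] =
    (\bigcap_(i in [set: 'I_3]) [set p : 'rV[R]_3 | 0 <= p 0 i]) `&`
    [set p : 'rV[R]_3 | \sum_i p 0 i = 1] `&`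
    (\bigcap_(i in [set i | i \in I]) [set p : 'rV[R]_3 | p 0 i = 0]).
    apply/seteqP; split=> [p [[h1 h2] h3]|p [[h1 h2] h3]].
      by split; [split=> // i _; apply: h1 | move=> i; apply: h3].
    by split; [split=> // i; apply: h1 | move=> i; apply: h3].
  apply: closedI; first apply: closedI.
  + by apply: closed_bigI => i _; exact: closed_coord_ge.
  + apply: (@closed_comp _ _ (fun p : 'rV[R]_3 => \sum_i p 0 i)
      [set u | u = 1]); last exact: closed_eq.
    move=> p _; apply: (@cvg_big _ _ _ _ _ _ _ (nbhs p)) => [|i _].
      exact: add_continuous.
    exact: coord_continuous.
  + by apply: closed_bigI => i _; exact: closed_coord_eq.
- have : compact [set v : 'rV[R]_3 | forall i, v ord0 i \in `[0, 1]].
    apply: (@rV_compact R 3 (fun=> `[0, 1]%classic : set R)).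
    by move=> _; exact: segment_compact.
  by [].
Qed.

Lemma compact_cell x I : compact (cell x I).
Proof.
apply: continuous_compact; last exact: compact_face.
have hc : {within @triangle R, continuous (draw x : _ -> (R * R)%type)} :=
  @draw_continuous _ T x.
by apply: (continuous_subspaceW _ hc) => p [].
Qed.

Lemma closed_cell x I : closed (cell x I).
Proof.
apply: compact_closed; last exact: compact_cell.
exact: norm_hausdorff.
Qed.

(** Only finitely many chambers come near [z], and their cells are closed. *)
Lemma near_avoid (F : chamber T -> {set 'I_3} -> Prop) z :
  (forall x I, F x I -> ~ cell x I z) ->
  \forall z' \near z, forall x I, F x I -> ~ cell x I z'.
Proof.
move=> hF; have [U zU finU] := @draw_locally_finite _ T z.
pose N := [set x : chamber T | (draw x @` @triangle R) `&` U !=set0].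
have cl I : closed (\bigcup_(x in N `&` [set x | F x I]) cell x I).
  apply: closed_bigcup; first exact: finite_setIl.
  by move=> x _; exact: closed_cell.
have near_I I : \forall z' \near z,
    ~ (\bigcup_(x in N `&` [set x | F x I]) cell x I) z'.
  apply: open_nbhs_nbhs; split; first exact: closed_openC.
  by case=> x [_ /= /hF].
have near_all := filter_forall _ near_I.
near=> z' => x I xI xz'.
have zU' : U z' by near: z'.
suff : ~ (\bigcup_(x in N `&` [set x | F x I]) cell x I) z'.
  apply; exists x => //; split=> //.
  by exists z'; split=> //; case: xz' => p [tp _] <-; exists p.
move: I {xI xz'}; near: z'; exact: near_all.
Unshelve. all: by end_near. Qed.

Lemma nbhs_planeP z (U : set (plane R)) : nbhs z U <->
  exists2 e, 0 < e & forall z' : plane R,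
    `|z'.1 - z.1| < e -> `|z'.2 - z.2| < e -> U z'.
Proof.
split=> [/nbhs_ballP [e e0 eU]|[e e0 eU]].
  exists e => // z' h1 h2; apply: eU; split; rewrite /ball /= distrC //.
apply/nbhs_ballP; exists e => // z' [h1 h2].
by apply: eU; rewrite distrC.
Qed.

Lemma corner_triangle k : triangle (corner R k).
Proof.
split=> [i|]; first by rewrite mxE; case: eqP => //= _; rewrite ler01.
rewrite (bigD1 k) //= mxE !eqxx big1 ?addr0 // => i ik.
by rewrite mxE (negPf ik).
Qed.

Definition contains x z := exists2 p, triangle p & draw x p = z.

Lemma cell_set0P x z : cell x finset.set0 z <-> contains x z.
Proof.
split=> [[p [tp _] <-]|[p tp <-]]; first by exists p.
by exists p => //; split=> // i; rewrite inE.
Qed.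

Lemma near_contains z :
  \forall z' \near z, forall x, contains x z' -> contains x z.
Proof.
have h x (I : {set 'I_3}) : I = finset.set0 /\ ~ contains x z -> ~ cell x I z.
  by move=> [-> +] /cell_set0P.
have := near_avoid h; apply: filterS => z' {}h x xz'.
by apply: contrapT => nx; apply: (h x finset.set0) => //; exact/cell_set0P.
Qed.

Section Sections.
Variable s : chamber T -> 'I_3 -> bool.

(** The values [s x i], attached to the sides of the chambers, describe a
    double covering of the plane, which over [A] is trivialised by [h].  Since
    the part of [A] in one chamber may be disconnected, the value of [h] on a
    chamber has to depend on the point of the chamber. *)
Definition is_section (A : set (plane R)) (h : plane R -> chamber T -> bool) :=
  (forall z x p i, A z -> triangle p -> draw x p = z -> p 0 i = 0 ->
     h z (adj i x) = h z x (+) s x i) /\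
  (forall z, A z -> \forall z' \near z,
     A z' -> forall x, contains x z' -> h z' x = h z x).

Lemma section_sub A B h : B `<=` A -> is_section A h -> is_section B h.
Proof.
move=> BA [h1 h2]; split=> [z x p i /BA|z /BA/h2]; first exact: h1.
by apply: filterS => z' + /BA.
Qed.

Lemma contains_linked x z p y : triangle p -> draw x p = z -> contains y z ->
  draw y p = z /\ linked [pred i | p 0 i == 0] x y.
Proof.
move=> tp dx [q tq dy].
have [pq xy] : p = q /\ linked [pred i | p 0 i == 0] x y.
  by apply/draw_eq => //; rewrite dx.
by split=> //; rewrite pq.
Qed.

Lemma draw_linked x y p : triangle p -> linked [pred i | p 0 i == 0] x y ->
  draw y p = draw x p.
Proof. by move=> tp xy; apply/esym/draw_eq. Qed.

(** The chambers at a point are linked through the sides that contain the point,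
    where both sections jump by the same amount. *)
Lemma section_diff A h h' z x y : is_section A h -> is_section A h' -> A z ->
  contains x z -> contains y z -> h z x (+) h' z x = h z y (+) h' z y.
Proof.
move=> [h1 _] [h1' _] Az [p tp dx] /(contains_linked tp dx) [_].
elim=> // {}y i xy -> /eqP pi0.
have dy : draw y p = z by rewrite (draw_linked tp xy).
rewrite (h1 _ _ _ _ Az tp dy pi0) (h1' _ _ _ _ Az tp dy pi0).
by case: (h z y) (h' z y) (s y i) => [] [] [].
Qed.

Definition curve (g : R -> plane R) := forall t, 0 <= t <= 1 ->
  forall U, nbhs (g t) U -> exists2 e, 0 < e &
    forall t', 0 <= t' <= 1 -> `|t' - t| < e -> U (g t').

Lemma curve_section_diff A h h' g x0 x1 : is_section A h -> is_section A h' ->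
  curve g -> (forall t, 0 <= t <= 1 -> A (g t)) ->
  contains x0 (g 0) -> contains x1 (g 1) ->
  h (g 0) x0 (+) h' (g 0) x0 = h (g 1) x1 (+) h' (g 1) x1.
Proof.
move=> sh sh' cg gA x0g x1g.
have [X XP] := choice (fun z => draw_cover T z).
have {}XP z : contains (X z) z by have [p] := XP z; exists p.
have A0 : A (g 0) by apply: gA; rewrite lexx ler01.
have A1 : A (g 1) by apply: gA; rewrite lexx ler01.
rewrite (section_diff sh sh' A0 x0g (XP _)).
rewrite (section_diff sh sh' A1 x1g (XP _)).
apply: (@locally_constant01 _
  (fun t => h (g t) (X (g t)) (+) h' (g t) (X (g t)))) => t t01.
have At := gA t t01.
have [e e0 he] := cg t t01 _
  (filterI (near_contains (g t)) (filterI (sh.2 _ At) (sh'.2 _ At))).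
exists e => // t' t01' /(he _ t01') [n1 [n2 n3]].
have At' := gA t' t01'.
rewrite n2 // n3 //.
by apply: (section_diff sh sh' At) (XP _); exact: n1.
Qed.

Lemma curve_section_const A h g x : is_section A h -> curve g ->
  (forall t, 0 <= t <= 1 -> A (g t) /\ contains x (g t)) ->
  h (g 0) x = h (g 1) x.
Proof.
move=> sh cg gA; apply: (@locally_constant01 _ (fun t => h (g t) x)) => t t01.
have [e e0 he] := cg t t01 _ (sh.2 _ (gA t t01).1).
by exists e => // t' t01' /(he _ t01'); apply; have [] := gA t' t01'.
Qed.

Definition seg z1 z2 (t : R) : plane R :=
  (z1.1 + t * (z2.1 - z1.1), z1.2 + t * (z2.2 - z1.2)).

Lemma seg_curve z1 z2 : curve (seg z1 z2).
Proof.
move=> t _ U /nbhs_planeP [e e0 eU].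
pose M := 1 + `|z2.1 - z1.1| + `|z2.2 - z1.2|.
have M1 : 1 <= M by rewrite /M -addrA lerDl addr_ge0.
have M0 : 0 < M by lra.
exists (e / M); first exact: divr_gt0.
move=> t' _; rewrite ltr_pdivlMr // => h.
have bound (w : R) : `|w| <= M -> `|t' * w - t * w| < e.
  move=> wM; rewrite -mulrBl normrM; apply: le_lt_trans h.
  exact: ler_wpM2l.
have n1 := normr_ge0 (z2.1 - z1.1); have n2 := normr_ge0 (z2.2 - z1.2).
apply: eU; rewrite /seg /= opprD addrACA subrr add0r; apply: bound;
  rewrite /M; lra.
Qed.

Definition convex (A : set (plane R)) := forall z1 z2 t, A z1 -> A z2 ->
  0 <= t <= 1 -> A (seg z1 z2 t).

Definition has_section A := exists h, is_section A h.

Lemma seg0 z1 z2 : seg z1 z2 0 = z1.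
Proof. by case: z1 => a b; rewrite /seg /= !mul0r !addr0. Qed.
Lemma seg1 z1 z2 : seg z1 z2 1 = z2.
Proof. by case: z1 z2 => a b [c d]; rewrite /seg /= !mul1r !subrKC. Qed.

Lemma convex_section_diff A h h' z1 z2 x1 x2 : is_section A h ->
  is_section A h' -> convex A ->
  A z1 -> A z2 -> contains x1 z1 -> contains x2 z2 ->
  h z1 x1 (+) h' z1 x1 = h z2 x2 (+) h' z2 x2.
Proof.
move=> sh sh' cA A1 A2 x1z x2z.
have := curve_section_diff (g := seg z1 z2) (x0 := x1) (x1 := x2) sh sh'.
rewrite seg0 seg1; apply=> //; first exact: seg_curve.
by move=> t; apply: cA.
Qed.

(** On the convex set where both sections are defined they differ by a constant
    [c], which is added to the second one. *)
Lemma section_glue A1 A2 : closed A1 -> closed A2 -> convex (A1 `&` A2) ->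
  has_section A1 -> has_section A2 -> has_section (A1 `|` A2).
Proof.
move=> cl1 cl2 cA [h1 s1] [h2 s2].
have s1I : is_section (A1 `&` A2) h1 by apply: section_sub s1 => z [].
have s2I : is_section (A1 `&` A2) h2 by apply: section_sub s2 => z [].
have [c hc] : exists c, forall z x, A1 z -> A2 z -> contains x z ->
    h2 z x (+) c = h1 z x.
  have [[z0 A0]|no] := pselect (exists z, (A1 `&` A2) z); last first.
    by exists false => z x z1 z2; case: no; exists z.
  have [x0 [p tp dx]] := draw_cover T z0.
  exists (h1 z0 x0 (+) h2 z0 x0) => z x z1 z2 xz.
  have -> := @convex_section_diff _ _ _ z0 z x0 x s1I s2I cA A0 (conj z1 z2)
    (ex_intro2 _ _ p tp dx) xz.
  by case: (h1 z x) (h2 z x) => [] [].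
(* Near a point of both sets, [near_contains] makes [hc] applicable. *)
exists (fun z x => if `[< A1 z >] then h1 z x else h2 z x (+) c); split.
  move=> z x p i zA tp dx pi0; case: asboolP => z1; first exact: (s1.1 _ _ p).
  by case: zA => // z2; rewrite (s2.1 _ _ p) // addbAC.
move=> z zA.
have nA (A : set (plane R)) : closed A -> ~ A z -> \forall z' \near z, ~ A z'.
  move=> clA nAz; apply: (@open_nbhs_nbhs (R * R)%type z (~` A)).
  by split=> //; exact: closed_openC.
case: asboolP => z1.
  have [z2|z2] := pselect (A2 z).
    apply: filterS (filterI (near_contains z)
      (filterI (s1.2 _ z1) (s2.2 _ z2))) => z' [n1 [n2 n3]] z'A x xz'.
    case: asboolP => z1'; first exact: n2.
    by case: z'A => // z2'; rewrite n3 // hc //; exact: n1.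
  apply: filterS (filterI (nA _ cl2 z2) (s1.2 _ z1)) => z' [n1 n2] z'A x xz'.
  by case: asboolP => z1'; [exact: n2 | case: z'A].
case: zA => // z2.
apply: filterS (filterI (nA _ cl1 z1) (s2.2 _ z2)) => z' [n1 n2] z'A x xz'.
by case: asboolP => // _; rewrite n2 //; case: z'A.
Qed.

Definition box (a b c d : R) : set (plane R) :=
  [set z | a <= z.1 <= b /\ c <= z.2 <= d].

Lemma convexI A B : convex A -> convex B -> convex (A `&` B).
Proof.
by move=> cA cB z1 z2 t [a1 b1] [a2 b2] t01; split; [apply: cA | apply: cB].
Qed.

Lemma convex_box a b c d : convex (box a b c d).
Proof.
move=> [x1 y1] [x2 y2] t [/= /andP[h1 h2] /andP[h3 h4]]
  [/= /andP[h5 h6] /andP[h7 h8]] /andP[t0 t1].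
by rewrite /box /seg /=; split; apply/andP; split; nra.
Qed.

Lemma closed_box a b c d : closed (box a b c d).
Proof.
have -> : box a b c d = (fst @^-1` `[a, b]%classic) `&`
    (snd @^-1` `[c, d]%classic).
  by apply/seteqP; split=> z; rewrite /box /= !in_itv.
apply: closedI; apply: closed_comp; last 1 [exact: itv_closed].
- by move=> z _; exact: cvg_fst.
- exact: itv_closed.
- by move=> z _; exact: cvg_snd.
Qed.

Section Locally.
Hypothesis local : forall z, exists2 U, nbhs z U & has_section U.

Lemma has_section_sub A B : B `<=` A -> has_section A -> has_section B.
Proof. by move=> BA [h sh]; exists h; exact: section_sub sh. Qed.

(** Sections over short boxes above [u] are stacked until they reach from [c]
    to [d]; only finitely many are needed, so a positive width remains. *)
Lemma section_strip (u c d : R) : c <= d -> exists2 e, 0 < e &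
  has_section (box (u - e) (u + e) c d).
Proof.
move=> cd; apply: (@interval_induction _ c d (fun c d => exists2 e, 0 < e &
  has_section (box (u - e) (u + e) c d))) => //.
  move=> y1 y2 y3 _ y12 y23 _ [e e0 he] [e' e0' he'].
  exists (Num.min e e'); first by rewrite lt_min e0.
  set m := Num.min e e'.
  have m1 : m <= e by rewrite ge_min lexx.
  have m2 : m <= e' by rewrite ge_min lexx orbT.
  apply: (@has_section_sub (box (u - m) (u + m) y1 y2 `|`
    box (u - m) (u + m) y2 y3)).
    move=> z [h1 /andP[h2 h3]]; have [zy|zy] := leP z.2 y2; [left|right].
      by split=> //; rewrite h2.
    by split=> //; rewrite h3 andbT ltW.
  apply: section_glue; [exact: closed_box|exact: closed_box| | |].
  - by apply: convexI; exact: convex_box.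
  - by apply: has_section_sub he => z [/andP[h1 h2] h3]; split=> //; lra.
  - by apply: has_section_sub he' => z [/andP[h1 h2] h3]; split=> //; lra.
move=> t _; have [U /nbhs_planeP [e e0 eU] sU] := local (u, t).
exists (e / 2); first lra.
move=> x y _ _ h1 h2; exists (e / 2); first lra.
apply: has_section_sub sU => z [/andP[h3 h4] /andP[h5 h6]].
by apply: eU; rewrite /= ltr_norml; lra.
Qed.

Lemma section_box a b c d : a <= b -> c <= d -> has_section (box a b c d).
Proof.
move=> ab cd; apply: (@interval_induction _ a b (fun a b =>
  has_section (box a b c d))) => //.
  move=> y1 y2 y3 _ y12 y23 _ he he'.
  apply: (@has_section_sub (box y1 y2 c d `|` box y2 y3 c d)).
    move=> z [/andP[h2 h3] h1]; have [zy|zy] := leP z.1 y2; [left|right].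
      by split=> //; rewrite h2.
    by split=> //; rewrite h3 andbT ltW.
  apply: section_glue => //; [exact: closed_box|exact: closed_box|].
  by apply: convexI; exact: convex_box.
move=> t _; have [e e0 he] := section_strip t cd.
exists e => // x y _ _ h1 h2.
by apply: has_section_sub he => z [/andP[h3 h4] h5]; split=> //; lra.
Qed.

Lemma cell_curve x p q : triangle p -> triangle q ->
  curve (fun t => draw x (p + t *: (q - p))) /\
  (forall t, 0 <= t <= 1 -> triangle (p + t *: (q - p))).
Proof.
move=> [p0 p1] [q0 q1].
have tri t : 0 <= t <= 1 -> triangle (p + t *: (q - p)).
  move=> /andP[t0 t1]; split.
    move=> i; rewrite !mxE; have := p0 i; have := q0 i; nra.
  under eq_bigr do rewrite !mxE.
  rewrite big_split /= -mulr_sumr sumrB p1 q1; lra.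
split=> // t t01 U.
have hc : {within @triangle R, continuous (draw x : _ -> (R * R)%type)} :=
  @draw_continuous _ T x.
have {hc} := (iffLR (subspace_continuousP _ _)) hc _ (tri t t01).
move=> hU /hU {}hU.
have {}hU : nbhs (p + t *: (q - p))
  [set p' | triangle p' -> U (draw x p')] := hU.
have cont : continuous (fun r : R => p + r *: (q - p)).
  move=> r; apply: cvgD; first exact: cvg_cst.
  by apply: cvgZr_tmp; exact: cvg_id.
have /nbhs_ballP [e /= e0 he] := cont t _ hU.
exists e => // t' t01' tt'; apply: (he t'); last exact: tri.
by rewrite /ball /= distrC.
Qed.

Definition bigbox (n : nat) : set (plane R) :=
  box (- n%:R) n%:R (- n%:R) n%:R.

Lemma cell_bounded x : exists n, forall m, (n <= m)%N ->
  forall p, triangle p -> bigbox m (draw x p).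
Proof.
have /compact_bounded [M [_ hM]] := @compact_cell x finset.set0.
have [n hn] : exists n : nat, M + 1 <= n%:R.
  exists (Num.bound `|M + 1|).
  by apply: le_trans (ler_norm _) (ltW _); exact: Num.Theory.archi_boundP.
exists n => m nm p tp.
have /(hM (M + 1)) : cell x finset.set0 (draw x p).
  by apply/cell_set0P; exists p.
rewrite ltrDl ltr01 => /(_ isT) /=; rewrite prod_normE ge_max => /andP[h1 h2].
have mn : n%:R <= m%:R :> R by rewrite ler_nat.
by split; rewrite -ler_norml; lra.
Qed.

(** The sections over growing boxes, normalised at the origin, agree on their
    common domains.  A chamber is bounded and connected, so a single value
    results for it. *)
Lemma global_potential :
  exists f : chamber T -> bool, forall x i, f (adj i x) = f x (+) s x i.
Proof.
have [x0 [p0 tp0 dx0]] := draw_cover T ((0, 0) : plane R).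
have Hex n : exists h, is_section (bigbox n) h /\ h (0, 0) x0 = false.
  have [||h sh] := @section_box (- n%:R) n%:R (- n%:R) n%:R.
  - by rewrite (@le_trans _ _ 0) ?oppr_le0 ?ler0n.
  - by rewrite (@le_trans _ _ 0) ?oppr_le0 ?ler0n.
  exists (fun z x => h z x (+) h (0, 0) x0); split; last exact: addbb.
  split=> [z x p i zA tp dx pi0|z /sh.2].
    by rewrite (sh.1 _ _ p) // addbAC.
  by apply: filterS => z' h1 zA x xz'; rewrite h1.
have [H HP] := choice Hex.
have [N NP] := choice cell_bounded.
pose c := corner R 0.
have tc := corner_triangle.
exists (fun x => H (N x) (draw x c) x).
have key x m p : (N x <= m)%N -> triangle p ->
    H m (draw x p) x = H (N x) (draw x c) x.
  move=> Nm tp.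
  have [cg gt] := cell_curve x tp (tc 0).
  have := curve_section_const (x := x) (HP m).1 cg.
  rewrite scale0r addr0 scale1r subrKC => ->; last first.
    move=> t t01; split; first by apply: NP => //; exact: gt.
    by exists (p + t *: (corner R 0 - p)) => //; exact: gt.
  have sub : bigbox (N x) `<=` bigbox m.
    have h : (N x)%:R <= m%:R :> R by rewrite ler_nat.
    by move=> z [/andP[h1 h2] /andP[h3 h4]]; split; lra.
  have B0 : bigbox (N x) (0, 0).
    by rewrite /bigbox /box /=; rewrite oppr_le0 ler0n.
  have Bc : bigbox (N x) (draw x c) by apply: NP => //; exact: tc.
  have := @convex_section_diff _ _ _ (0, 0) (draw x c) x0 x
    (section_sub sub (HP m).1) (HP (N x)).1 (@convex_box _ _ _ _) B0 Bc
    (ex_intro2 _ _ p0 tp0 dx0) (ex_intro2 _ _ c (tc 0) erefl).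
  rewrite (HP m).2 (HP (N x)).2 /= -/c.
  by case: (H m (draw x c) x) (H (N x) _ _) => [] [].
move=> x i.
pose m := maxn (N x) (N (adj i x)).
(* Compare the two chambers at one of the ends of their common side. *)
pose k := i + 1; pose p := corner R k.
have pi0 : p 0 i = 0.
  have ki : (i == i + 1) = false by case: (i) => [[|[|[|]]]].
  by rewrite mxE ki andbF.
have tp : triangle p := tc k.
rewrite -(key x m p) ?leq_maxl // -(key (adj i x) m p) ?leq_maxr //.
have -> : draw (adj i x) p = draw x p.
  apply: draw_linked => //; apply: linked_adj; first exact: linked_refl.
  by rewrite /= pi0.
by apply: ((HP m).1.1 _ _ p) => //; apply: NP; rewrite ?leq_maxl.
Qed.

End Locally.
End Sections.

Lemma triangle_coord_neq0 p : triangle p -> exists k, p 0 k != 0.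
Proof.
move=> [_ p_sum]; apply: contrapT => no.
have : \sum_i p 0 i = 0.
  rewrite big1 // => i _; apply/eqP/negPn/negP => h; apply: no; by exists i.
by rewrite p_sum; apply/eqP/oner_neq0.
Qed.

(** The sides other than the k-th one are those that meet at the vertices of
    type [k].  A point of the plane avoids the sides of some type [k], hence so
    do the points near it, and [t k] is a section there. *)
Lemma local_potentials_glue (s : chamber T -> 'I_3 -> bool)
    (t : 'I_3 -> chamber T -> bool) :
  (forall k i x, i != k -> t k (adj i x) = t k x (+) s x i) ->
  exists f : chamber T -> bool, forall x i, f (adj i x) = f x (+) s x i.
Proof.
move=> ht; apply: global_potential => z.
have [x0 [p0 tp0 dx0]] := draw_cover T z.
have [k pk] := triangle_coord_neq0 tp0.
(* The sides of type [k] of all chambers avoid [z], hence a neighbourhood. *)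
exists [set z' | forall x I, I = finset.set1 k -> ~ cell x I z'].
  apply: near_avoid => x I -> [p [tp pk0] dx].
  have [pp0 _] : p = p0 /\ linked [pred i | p 0 i == 0] x x0.
    by apply/draw_eq => //; rewrite dx.
  by move: pk; rewrite -pp0 pk0 ?eqxx // inE.
exists (fun _ x => t k x); split=> [z' x p i zU tp dx pi0|z' _]; last first.
  by apply: filterE => z'' _ x _.
apply: ht; apply/eqP => ik; apply: (zU x _ erefl).
by exists p => //; split=> // j; rewrite inE => /eqP ->; rewrite -ik.
Qed.
End Drawing.

(** * The decoration is a sphere *)

Section Tilings.
Variables (R : realType) (T : tiling R).
Local Notation CT := (chamber_system T).

Lemma sub1_3 (i : 'I_3) : i - 1 - 1 = i + 1.
Proof. by apply/val_inj; case: i => [[|[|[|]]]]. Qed.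
Lemma add1_3 (i : 'I_3) : i + 1 + 1 = i - 1.
Proof. by apply/val_inj; case: i => [[|[|[|]]]]. Qed.

(** The dart with [x] on its left that starts at the vertex of type [k] of
    [x]. *)
Definition dart_at (k : 'I_3) (x : chamber T) : CT := (x, turn (~~ x.2) k).

Lemma source_dart_at k x : source_type (dart_at k x) = k.
Proof. by have := turnK (~~ x.2) k; rewrite negbK. Qed.

Lemma dart_at_source (d : CT) : d = dart_at (source_type d) d.1.
Proof. by case: d => x i; rewrite /dart_at /source_type turnK. Qed.

Lemma source_sigma (d : CT) : source_type (sigma d) = source_type d.
Proof.
case: d => x i; rewrite /source_type /= adj_snd /turn.
by case: x.2 => /=; rewrite ?sub1_3 ?add1_3.
Qed.

Lemma turn_neq b (i : 'I_3) : turn b i != i.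
Proof. by case: b; case: i => [[|[|[|]]]]. Qed.

(** Turning round its vertex of type [k], one crosses the side [i] from [x] or
    into [x], depending on the orientation of [x]. *)
Lemma dart_at_adj k i x : i != k ->
  sigma (dart_at k x) = dart_at k (adj i x) /\ (dart_at k x).2 = i
  \/ sigma (dart_at k (adj i x)) = dart_at k x /\ (dart_at k (adj i x)).2 = i.
Proof.
move=> ik.
have H y : turn (~~ y.2) k = i -> sigma (dart_at k y) = dart_at k (adj i y).
  move=> e; rewrite [LHS]dart_at_source source_sigma source_dart_at.
  by rewrite /dart_at /= e.
have [e|ne] := eqVneq (turn (~~ x.2) k) i; [left|right].
  by rewrite H.
have e : turn (~~ (adj i x).2) k = i.
  rewrite adj_snd negbK; apply/eqP; move: ne ik; rewrite /turn.
  by case: x.2 => /=; case: (k) (i) => [[|[|[|]]] ?] // [[|[|[|]]]].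
by rewrite H // adjK.
Qed.

(** At the vertices of type [k] the function [phi] is a local potential. *)
Lemma tiling_potential (s : CT -> bool) (phi : CT -> bool) :
  (forall d, s (theta d) = s d) -> (forall d, phi (sigma d) = phi d (+) s d) ->
  exists f : chamber T -> bool,
    (forall x i, f (adj i x) = f x (+) s (x, i)) /\
    (forall k i x, i != k ->
       phi (dart_at k (adj i x)) = phi (dart_at k x) (+) s (x, i)).
Proof.
move=> st ps.
have pk k i x : i != k ->
    phi (dart_at k (adj i x)) = phi (dart_at k x) (+) s (x, i).
  case/(@dart_at_adj _ _ x) => [[<- e]|[<- e]]; rewrite ps.
    by rewrite -e.
  have -> : dart_at k (adj i x) = theta ((x, i) : CT).
    by rewrite [LHS]surjective_pairing e.
  by rewrite st addbK.
have [f hf] := local_potentials_glue (T := T) (s := fun x i => s (x, i))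
  (t := fun k x => phi (dart_at k x)) pk.
by exists f.
Qed.

Lemma source_point_sigma (d : CT) : source_point (sigma d) = source_point d.
Proof.
rewrite /source_point source_sigma; apply/esym.
apply/draw_eq; [exact: corner_triangle|exact: corner_triangle|split=> //].
apply: linked_adj; first exact: linked_refl.
case: d => x i; rewrite /= mxE eqxx /source_type /=.
by rewrite [i == _]eq_sym (negPf (turn_neq _ _)).
Qed.

(** All chambers around a vertex contain it, so there are finitely many of them
    by local finiteness, and turning round the vertex has to come back. *)
Lemma tiling_finite_degrees : finite_degrees CT.
Proof.
move=> d; pose it n : CT := iter n (@sigma CT) d.
have src n : source_point (it n) = source_point d.
  by elim: n => // n IHn; rewrite /it iterS source_point_sigma.
have typ n : source_type (it n) = source_type d.
  by elim: n => // n IHn; rewrite /it iterS source_sigma.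
have [U dU /finite_seqP [cs csE]] := @draw_locally_finite _ T (source_point d).
have mem n : (it n).1 \in cs.
  have : [set` cs] (it n).1; last by [].
  rewrite -csE /=; exists (source_point d).
  split; last exact: nbhs_singleton dU.
  by exists (corner R (source_type (it n)));
    [exact: corner_triangle | exact: src].
have /(uniqPn (it 0).1) [i [j [ij js]]] :
    ~~ uniq [seq (it n).1 | n <- iota 0 (size cs).+1].
  apply/negP => u; have := uniq_leq_size u (s2 := cs).
  rewrite size_map size_iota ltnn => h; suff: false by []; apply: h.
  by move=> _ /mapP [n _ ->].
move: js; rewrite size_map size_iota => js.
have is_ := ltn_trans ij js.
rewrite !(nth_map 0%N) ?size_iota // !nth_iota // !add0n => e.
exists (j - i)%N; first by rewrite subn_gt0.
apply: (@iter_sigma_inj CT i); rewrite -iterD subnKC ?(ltnW ij) //.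
change (it j = it i).
by rewrite (dart_at_source (it i)) (dart_at_source (it j)) !typ e.
Qed.
End Tilings.

Section Decorations.
Variables (R : realType) (L : lopsp R).
Local Notation CT := (chamber_system L).

Lemma decoration_finite_degrees : finite_degrees (decoration L).
Proof.
move=> e; rewrite -[e]representativeK.
have [n n0 en] := tiling_finite_degrees (representative e).
exists n => //; rewrite -{2}en; elim: n {n0 en} => //= n ->.
exact: dsigma_pi.
Qed.

Lemma rotation_fix (c : plane R) a : rotation c a c = c.
Proof.
by case: c => x y; rewrite /rotation /= !subrr !mulr0 !addr0 subr0 addr0.
Qed.

(** The potentials [f] and [f] composed with the symmetry differ by a constant.
    A chamber containing the centre of the rotation is linked to its image
    through sides containing the centre.  Along these sides [f] changes like
    the potential [phi], which is invariant, so the constant is 0. *)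
Lemma potential_invariant (s phi f : _ -> bool) (c : plane R) a (g : L -> L) :
  symmetry_inducing (rotation c a) g ->
  (forall d : CT, s (act_cdart g d) = s d) ->
  (forall d : CT, phi (act_cdart g d) = phi d) ->
  (forall (x : chamber L) i, f (adj i x) = f x (+) s (x, i)) ->
  (forall k i (x : chamber L), i != k ->
       phi (dart_at k (adj i x)) = phi (dart_at k x) (+) s (x, i)) ->
  forall x, f (act_chamber g x) = f x.
Proof.
move=> [ig gc] sg pg fE pE.
pose diff x := f (act_chamber g x) (+) f x.
have diff_adj i x : diff (adj i x) = diff x.
  rewrite /diff -act_adj // !fE (_ : s (act_chamber g x, i) = s (x, i)).
    by case: (f _) (f x) (s _) => [] [] [].
  exact: (sg (x, i)).
have [x0 [p [tp0 tp1] dx]] := draw_cover L c.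
have tp : triangle p by [].
have x0c : cell x0 finset.set0 c by apply/cell_set0P; exists p.
have : cell (act_chamber g x0) finset.set0 c.
  by rewrite -gc; exists c => //; exact: rotation_fix.
move=> /cell_set0P /(contains_linked tp dx) [_ lk].
have [k pk] := triangle_coord_neq0 tp.
have d0 : diff x0 = false.
  suff H y : linked [pred i | p 0 i == 0] x0 y ->
      f y (+) phi (dart_at k y) = f x0 (+) phi (dart_at k x0).
    move: (H _ lk); rewrite /diff.
    rewrite [phi (dart_at _ (act_chamber _ _))](pg (dart_at k x0)).
    by case: (f _) (f x0) (phi _) => [] [] [].
  elim=> // {}y i _ <- /eqP pi0.
  have ik : i != k by apply: contraNneq pk => <-; rewrite pi0.
  rewrite fE pE //; by case: (f y) (phi _) (s _) => [] [] [].
have D0 (e : L) : diff (e, false) = diff (e, true).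
  exact: (diff_adj 0 (e, true)).
have Dt (e : L) : diff (theta e, true) = diff (e, true).
  by rewrite -D0; exact: (diff_adj (1 + 1) (e, true)).
have Ds (e : L) : diff (sigma e, true) = diff (e, true).
  have := diff_adj 1 (sigma e, true).
  by rewrite /adj /= sigmaK D0 Dt => ->.
have all0 : diff x0 = false -> forall x, diff x = false.
  have : [set e : L | diff (e, true) = false] = set0 \/
         [set e : L | diff (e, true) = false] = setT.
    by apply: (@tconnected _ L) => e /=; rewrite ?Ds ?Dt.
  case=> /seteqP [H H'] h0 [e b].
    case: (H x0.1); rewrite /= -h0; case: (x0) => [e0 []] //=.
  have := H' e I; case: b => //=; by rewrite D0.
by move=> x; have := all0 d0 x; rewrite /diff; case: (f _) (f x) => [] [].
Qed.

(** The set of edges is lifted to the tiling, which it cuts into two sides.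
    Both rotations preserve each side, so the sides are unions of orbits. *)
Lemma decoration_even_sets_separate : even_sets_separate (decoration L).
Proof.
move=> z phi zt ps.
pose s (d : CT) := z (orbit_of d); pose psi (d : CT) := phi (orbit_of d).
have [f [fE pE]] : exists f : chamber L -> bool,
    (forall x i, f (adj i x) = f x (+) s (x, i)) /\
    (forall k i x, i != k ->
       psi (dart_at k (adj i x)) = psi (dart_at k x) (+) s (x, i)).
  apply: tiling_potential => d; first by rewrite /s -dtheta_pi zt.
  by rewrite /psi -dsigma_pi ps.
have orb_inv g (u : decoration L -> bool) :
    (forall d, same_orbit d (act_cdart g d)) ->
    forall d, u (orbit_of (act_cdart g d)) = u (orbit_of d).
  by move=> h d; congr u; apply/esym/orbit_ofP.
have f0 x : f (act_chamber (@rho0 _ L) x) = f x.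
  by apply: (potential_invariant (rho0P L) _ _ fE pE);
    apply: orb_inv => d; apply: orbit_rho0; apply: orbit_refl.
have f2 x : f (act_chamber (@rho2 _ L) x) = f x.
  by apply: (potential_invariant (rho2P L) _ _ fE pE);
    apply: orb_inv => d; apply: orbit_rho2; apply: orbit_refl.
have f_orbit d d' : same_orbit d d' -> f d'.1 = f d.1.
  by elim=> // {}d' _; rewrite ?f0 ?f2.
exists (fun e => f (representative e).1) => e.
have fpi d : f (representative (orbit_of d)).1 = f d.1.
  by apply/esym/f_orbit; exact: same_orbit_repr.
rewrite -[e]representativeK; move: (representative e) => [x i] {e}.
rewrite /= dsigma_pi dtheta_pi !fpi /= fE.
by [].
Qed.

End Decorations.

Theorem theorem2p7 (R : realType) (G : plane_graph) (L : lopsp R)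
    (P Q : lopsp_path L) :
  isomorphic (application P G) (application Q G).
Proof.
have [g fg E] := labels_gauge_equivalent P Q
  (@decoration_finite_degrees R L) (@decoration_even_sets_separate R L).
exact: application_isomorphic fg E.
Qed.
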